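(* Let $C: f=0$ be a reduced plane curve of degree $d\geq 3$ in $\mathbb{P}^2$ of type $(d,r,m)$ with $m>3$, and suppose $\Delta m:=(2r-d+3)-m=1$. Then, with $\epsilon_1,\ldots,\epsilon_{m-2}$ as in the context, one has $\epsilon_{m-2}=2$, $\epsilon_j=1$ for $1\leq j\leq m-3$, and $$\tau(C)=\frac{d(d-1)}{2}-1+r(d-r-2).$$
   Context: Let $S=\mathbb{C}[x,y,z]$, let $f\in S$ be a reduced homogeneous polynomial of degree $d\geq 3$ defining $C$, and assume $C$ is not a union of $d$ lines through one point. Let $J_f=(f_x,f_y,f_z)$ and $M(f)=S/J_f$. Let $D_0(f)=\{(a,b,c)\in S^3: af_x+bf_y+cf_z=0\}$. The curve is of type $(d,r,m)$ if $D_0(f)$ is minimally generated by $m$ homogeneous elements all of degree $r$. When $m\geq 3$, the minimal graded free resolution of $M(f)$ has the form $$0\to \bigoplus_{i=1}^{m-2}S(-e_i)\to \bigoplus_{j=1}^m S(1-d-r)\to S^3(1-d)\to S,$$ with $e_1\leq\cdots\leq e_{m-2}$, and one writes $e_j=d+r-1+\epsilon_j$ with integers $\epsilon_j\geq 1$. The total Tjurina number $\tau(C)$ is the degree of $J_f$, i.e. the sum of the Tjurina numbers of the singular points of $C$. *)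

(* Defs.v *)
From HB Require Import structures.
From mathcomp Require Import all_boot all_algebra.
From mathcomp Require Import complex.
From mathcomp Require Import Rstruct.
From mathcomp Require Import mpoly.
Set Implicit Arguments.
Unset Strict Implicit.
Unset Printing Implicit Defensive.
Import GRing.Theory.
Local Open Scope ring_scope.

Definition CC : numClosedFieldType := (Rdefinitions.R)[i].

Notation S := {mpoly CC[3]}.

Definition pd (i : 'I_3) (f : S) : S := mderiv i f.

Definition reduced (f : S) : Prop :=
  f != 0 /\ forall g h : S, f = g * g * h -> (msize g <= 1)%N.

Definition lines_through_point (d : nat) (f : S) : Prop :=
  exists p : 'I_3 -> CC, (exists i, p i != 0) /\
  exists (c : CC) (L : 'I_d -> S),
    (forall j, L j \is 1.-homog /\ L j != 0 /\ (L j).@[p] = 0) /\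
    f = c *: \prod_(j < d) L j.

(* A vector of S^n (row vector) is homogeneous of degree k
   when all its components are (0 counts as homogeneous of every degree). *)
Definition homog_row (n k : nat) (v : 'rV[S]_n) : Prop :=
  forall i, v 0 i \is k.-homog.

Definition generates (n t : nat) (M : 'rV[S]_n -> Prop) (g : 'I_t -> 'rV[S]_n)
  : Prop :=
  (forall j, M (g j)) /\
  forall v, M v -> exists a : 'I_t -> S, v = \sum_(j < t) a j *: g j.

Definition needs_at_least (n m : nat) (M : 'rV[S]_n -> Prop) : Prop :=
  forall (t : nat) (g : 'I_t -> 'rV[S]_n),
    (forall j, exists k, homog_row k (g j)) -> generates M g -> (m <= t)%N.

Definition D0 (f : S) (v : 'rV[S]_3) : Prop :=
  \sum_(i < 3) v 0 i * pd i f = 0.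

Definition min_gens_D0 (f : S) (r m : nat) (rho : 'I_m -> 'rV[S]_3) : Prop :=
  (forall j, homog_row r (rho j)) /\ generates (D0 f) rho /\
  @needs_at_least 3 m (D0 f).

Definition curve_type (f : S) (d r m : nat) : Prop :=
  f \is d.-homog /\ exists rho : 'I_m -> 'rV[S]_3, @min_gens_D0 f r m rho.

(* Module of relations among the generators rho_1..rho_m (second syzygies):
   the image of  (+)_i S(-e_i) -> (+)_j S(1-d-r). *)
Definition relations (m : nat) (rho : 'I_m -> 'rV[S]_3) (a : 'rV[S]_m) : Prop :=
  \sum_(j < m) a 0 j *: rho j = 0.

Definition inJ (f g : S) : Prop :=
  exists a : 'I_3 -> S, g = \sum_(i < 3) a i * pd i f.

Definition indep_mod_J (f : S) (k t : nat) : Prop :=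
  exists p : 'I_t -> S, (forall j, p j \is k.-homog) /\
    forall c : 'I_t -> CC, (exists j, c j != 0) ->
      ~ inJ f (\sum_(j < t) c j *: p j).

Definition hilb_MJ (f : S) (k h : nat) : Prop :=
  indep_mod_J f k h /\ ~ indep_mod_J f k h.+1.

(* tau(C) = deg J_f: the (eventually constant) value of the Hilbert
   function of M(f) = S/J_f, i.e. its Hilbert polynomial. *)
Definition total_tjurina (f : S) (tau : nat) : Prop :=
  exists N : nat, forall k, (N <= k)%N -> hilb_MJ f k tau.

(* Main.v *)
(* The relations K between the m generators of D_0(f) form a third syzygy module
   over k[x,y,z]: x, y is a regular sequence on K and K/(x,y)K embeds in k[z]^m.
   Evaluating K_n at (0,0,1) thus gives an increasing chain of subspaces W_n of k^m,
   with W_0 = 0 by minimality, whose dimensions w_n are the second differences of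
   n |-> dim K_n; lifting bases of the W_n gives a basis of K.

   The Hilbert function of M(f) has first difference
   (m - 3 - w_1) + sum_(2 <= j <= n+1) (m - 2 - w_j) in degree d - 1 + r + n.
   If it is eventually constant, this vanishes for large n, which forces w_1 = m - 3
   and w_j = m - 2 for j >= 2: one relation of degree 2 and the others of degree 1.

   Eventual constancy is where f being reduced enters.  In an affine chart f is a
   square-free polynomial in s over k[y], so that its discriminant D(y) is nonzero
   and some line L = 0 meets the curve transversally.  On that line the partial
   derivatives of f generate an ideal primary to the origin, so multiplication by L
   is onto from M(f)_n to M(f)_(n+1) for large n. *)
Require Import Defs.
From HB Require Import structures.
From mathcomp Require Import all_boot all_order all_algebra all_field.
From mathcomp Require Import complex.
From mathcomp Require Import Rstruct.
From mathcomp Require Import mpoly.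
From mathcomp Require Import zify ring.
From Stdlib Require Import Classical.
Set Implicit Arguments.
Unset Strict Implicit.
Unset Printing Implicit Defensive.
Import GRing.Theory Num.Theory.
Local Open Scope ring_scope.

(** * Substitution and homogeneous components *)

Section Substitution.

Lemma rmorph_mmap n (R : nzRingType) (T U : comNzRingType)
    (f : {rmorphism T -> U}) (c : {rmorphism R -> T}) (h : 'I_n -> T)
    (p : {mpoly R[n]}) :
  f (mmap c h p) = mmap (f \o c) (f \o h) p.
Proof.
rewrite /mmap rmorph_sum; apply: eq_bigr => m _.
rewrite rmorphM; congr (_ * _).
by rewrite /mmap1 rmorph_prod; apply: eq_bigr => i _; rewrite rmorphXn.
Qed.

Lemma mmap_mpolyC_id n (R : comNzRingType) (p : {mpoly R[n]}) :
  mmap (@mpolyC n R) (fun i => 'X_i) p = p.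
Proof.
rewrite -[RHS]comp_mpoly_id; apply: eq_bigr => m _; congr (_ * _).
by apply: mmap1_eq => i; rewrite tnth_mktuple.
Qed.

Lemma eq_mmap n (R : nzRingType) (T : comNzRingType) (c : R -> T)
    (h1 h2 : 'I_n -> T) : h1 =1 h2 -> mmap c h1 =1 mmap c h2.
Proof.
by move=> e p; apply: eq_bigr => m _; rewrite (mmap1_eq _ e).
Qed.

Lemma mmap_homogZ n (R : nzRingType) (T : comNzRingType)
    (c : {rmorphism R -> T}) (t : T) (h : 'I_n -> T) d (p : {mpoly R[n]}) :
  p \is d.-homog -> mmap c (fun i => t * h i) p = t ^+ d * mmap c h p.
Proof.
move=> /dhomogP hp; rewrite /mmap mulr_sumr big_seq [RHS]big_seq.
apply: eq_bigr => m /hp e; have {e} <- : mdeg m = d by []; rewrite mulrCA; congr (_ * _).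
rewrite /mmap1 mdegE -prodrXr -big_split /=.
by apply: eq_bigr => i _; rewrite exprMn.
Qed.

(** The pairs congruent modulo the ideal of the [g i - h i] are stable under sums and products. With
    [g] the variables, this yields explicit membership in ideals of linear forms. *)
Lemma mmap_sub_ideal n (R : nzRingType) (T : comNzRingType)
    (c : {rmorphism R -> T}) (g h : 'I_n -> T) (p : {mpoly R[n]}) :
  exists q : 'I_n -> T,
    mmap c g p - mmap c h p = \sum_i q i * (g i - h i).
Proof.
pose I (a b : T) := exists q : 'I_n -> T, a - b = \sum_i q i * (g i - h i).
have I0 a : I a a.
  by exists (fun=> 0); rewrite subrr big1 // => i _; rewrite mul0r.
have IM a b a' b' : I a b -> I a' b' -> I (a * a') (b * b').
  move=> [q e] [q' e']; exists (fun i => a' * q i + b * q' i).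
  have -> : a * a' - b * b' = a' * (a - b) + b * (a' - b') by ring.
  rewrite e e' !mulr_sumr -big_split; apply: eq_bigr => i _ /=; ring.
have ID a b a' b' : I a b -> I a' b' -> I (a + a') (b + b').
  move=> [q e] [q' e']; exists (fun i => q i + q' i).
  have -> : a + a' - (b + b') = (a - b) + (a' - b') by ring.
  rewrite e e' -big_split; apply: eq_bigr => i _ /=; ring.
have Ig i : I (g i) (h i).
  exists (fun j => (j == i)%:R); rewrite (bigD1 i) //= eqxx mul1r big1 ?addr0 //.
  by move=> j /negbTE ->; rewrite mul0r.
rewrite -/(I _ _); elim/mpolyind: p => [|a m p _ _ IHp].
  by rewrite !mmap0; exact: I0.
rewrite !mmapD !mmapZ; apply: ID => //; apply: (IM); first exact: I0.
rewrite !mmapX /mmap1; apply: (big_ind2 I) => [|u u' v v'|i _]; [exact: I0 | exact: IM |].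
elim: (m i) => [|k IHk]; first by rewrite !expr0.
by rewrite !exprS; apply: IM.
Qed.

End Substitution.

Section HomogComponents.
Variables (n : nat) (R : comNzRingType).
Implicit Types p q : {mpoly R[n]}.

Lemma pihomog_mulr e k p q : p \is e.-homog ->
  pihomog mdeg (k + e) (p * q) = p * pihomog mdeg k q.
Proof.
move=> hp; elim/mpolyind: q => [|a m q _ _ IHq].
  by rewrite mulr0 !raddf0 mulr0.
rewrite mulrDr !pihomogD mulrDr IHq; congr (_ + _).
rewrite -scalerAr !linearZ /= -scalerAr; congr (_ *: _).
rewrite pihomogX; case: eqP => [<-|/eqP ne].
  by rewrite pihomog_dE // addnC dhomogM // dhomogX.
rewrite mulr0 (@pihomog_ne0 _ _ _ (e + mdeg m)%N) //; last first.
  by rewrite dhomogM // dhomogX.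
by rewrite addnC eqn_add2r.
Qed.

End HomogComponents.

(** * Divisibility and the Koszul relation in three variables *)

Section Variables3.
Variable F : fieldType.
Local Notation S := {mpoly F[3]}.
Local Notation x := ('X_ord0 : S).
Local Notation y := ('X_(inord 1) : S).

Lemma ord3P (P : 'I_3 -> Prop) :
  P ord0 -> P (inord 1) -> P ord_max -> forall i, P i.
Proof.
move=> p0 p1 p2 i; have [e|[e|e]] : i = ord0 \/ i = inord 1 \/ i = ord_max.
  by case: i => -[|[|[|//]]] ltn; [left | right; left | right; right];
     apply: val_inj; rewrite //= inordK.
all: by rewrite e.
Qed.

Lemma big_ord3 (V : nmodType) (h : 'I_3 -> V) :
  \sum_i h i = h ord0 + h (inord 1) + h ord_max.
Proof.
rewrite !big_ord_recr big_ord0 /= add0r; congr (h _ + h _ + h _); apply: val_inj => //=.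
by rewrite inordK.
Qed.

Lemma mpolyX_neq0 (i : 'I_3) : ('X_i : S) != 0.
Proof. by rewrite -msize_poly_eq0 msizeX mdeg1. Qed.

Lemma mpolyX_dvd (i : 'I_3) (p : S) :
  mmap (@mpolyC 3 F) (fun j => if j == i then 0 else 'X_j) p = 0 ->
  exists q, p = 'X_i * q.
Proof.
move=> p0.
have [q] := mmap_sub_ideal (@mpolyC 3 F) (fun j => 'X_j : S)
  (fun j => if j == i then 0 else 'X_j) p.
rewrite p0 subr0 mmap_mpolyC_id => ->; exists (q i).
rewrite (bigD1 i) //= eqxx subr0 mulrC big1 ?addr0 // => j /negbTE ->.
by rewrite subrr mulr0.
Qed.

Definition evz (p : S) : F := p.@[fun i => (i == ord_max)%:R].

(** Modulo [x] and [y], a form of degree [n] is its value at (0,0,1) times the [n]-th power of the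
    third variable. *)
Lemma mem_ideal_xy n (p : S) : p \is n.-homog -> evz p = 0 ->
  exists a b, p = x * a + y * b.
Proof.
move=> hp p0.
have [q] := mmap_sub_ideal (@mpolyC 3 F) (fun j => 'X_j : S)
  (fun j => 'X_ord_max * (j == ord_max)%:R) p.
rewrite (mmap_homogZ _ _ _ hp).
have -> : mmap (@mpolyC 3 F) (fun j : 'I_3 => (j == ord_max)%:R) p = 0.
  rewrite -[0](mpolyC0 3 F) -p0 /evz /meval (rmorph_mmap (@mpolyC 3 F)).
  by apply: eq_mmap => i /=; rewrite raddfMn /=.
rewrite mulr0 subr0 mmap_mpolyC_id => ->; exists (q ord0), (q (inord 1)).
rewrite big_ord3 eqxx mulr1 subrr (mulr0 (q ord_max)) addr0.
have -> : (inord 1 == ord_max :> 'I_3) = false by rewrite -val_eqE /= inordK.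
by rewrite /= !mulr0 !subr0 mulrC [_ * y]mulrC.
Qed.

(** Setting [x] to 0 leaves [y] times the reduction of [b], so [x] divides [b]; cancelling [x] then
    determines [a]. *)
Lemma koszul_xy (a b : S) : x * a + y * b = 0 ->
  exists c, a = y * c /\ b = - (x * c).
Proof.
move=> e; have [c ec] : exists c, b = x * c.
  apply: mpolyX_dvd; move/(congr1 (mmap (@mpolyC 3 F)
    (fun j => if j == ord0 then 0 else 'X_j))): e.
  rewrite rmorphD !rmorphM raddf0 /= !mmapX !mmap1U eqxx mul0r add0r.
  have -> : (inord 1 == ord0 :> 'I_3) = false by rewrite -val_eqE /= inordK.
  by move/eqP; rewrite mulf_eq0 (negbTE (mpolyX_neq0 _)) /= => /eqP.
exists (- c); rewrite !mulrN opprK; split => //.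
apply: (mulfI (mpolyX_neq0 ord0)); apply/eqP; rewrite -subr_eq0 -e ec.
by apply/eqP; ring.
Qed.

End Variables3.

(** * Graded pieces of free modules *)

Section GradedRows.
Variable F : fieldType.
Local Notation S := {mpoly F[3]}.

Notation gr m n := {ffun 'I_m -> dhomog 3 F n}.

Definition homog_mx (m p e : nat) (M : 'M[S]_(m, p)) :=
  forall i j, M i j \is e.-homog.

Definition row_of m n (u : gr m n) : 'rV[S]_m := \row_i (u i : S).

(** Truncation to degree [n] makes this total, so no proof of homogeneity has to be carried. *)
Definition gr_of m n (v : 'rV[S]_m) : gr m n :=
  [ffun i => DHomog (pihomogP mdeg n (v 0 i))].

Definition hcomp m n (v : 'rV[S]_m) : 'rV[S]_m := map_mx (pihomog mdeg n) v.

Lemma row_of_gr_of m n (v : 'rV[S]_m) : row_of (gr_of n v) = hcomp n v.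
Proof. by apply/rowP => i; rewrite !mxE ffunE. Qed.

Lemma row_of_inj m n : injective (@row_of m n).
Proof.
move=> u v e; apply/ffunP => i; apply: val_inj.
by have /rowP/(_ i) := e; rewrite !mxE.
Qed.

Lemma homog_row_of m n (u : gr m n) : homog_mx n (row_of u).
Proof. by move=> i j; rewrite mxE; exact: dhomog_is_dhomog. Qed.

Lemma hcomp_id m n (v : 'rV[S]_m) : homog_mx n v -> hcomp n v = v.
Proof. by move=> hv; apply/rowP => i; rewrite mxE pihomog_dE. Qed.

Lemma gr_ofK m n (v : 'rV[S]_m) : homog_mx n v -> row_of (gr_of n v) = v.
Proof. by move=> hv; rewrite row_of_gr_of hcomp_id. Qed.

Lemma row_ofD m n (u v : gr m n) : row_of (u + v) = row_of u + row_of v.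
Proof. by apply/rowP => i; rewrite !mxE ffunE. Qed.

Lemma row_of0 m n : row_of (0 : gr m n) = 0.
Proof. by apply/rowP => i; rewrite !mxE ffunE. Qed.

Lemma row_ofZ m n (c : F) (u : gr m n) : row_of (c *: u) = c%:MP *: row_of u.
Proof. by apply/rowP => i; rewrite !mxE ffunE /= mul_mpolyC. Qed.

Lemma hcompD m n (u v : 'rV[S]_m) : hcomp n (u + v) = hcomp n u + hcomp n v.
Proof. by apply/rowP => i; rewrite !mxE raddfD. Qed.

Lemma hcomp_mulmx m p e n (v : 'rV[S]_m) (M : 'M[S]_(m, p)) :
  homog_mx e M -> hcomp (n + e) (v *m M) = hcomp n v *m M.
Proof.
move=> hM; apply/rowP => j; rewrite !mxE raddf_sum /=; apply: eq_bigr => i _.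
by rewrite mulrC pihomog_mulr // mulrC mxE.
Qed.

Lemma hcompZ m n (i : 'I_3) (v : 'rV[S]_m) :
  hcomp n.+1 ('X_i *: v) = 'X_i *: hcomp n v.
Proof.
apply/rowP => j; rewrite !mxE -[n.+1]addn1 pihomog_mulr //.
by rewrite dhomogX /= mdeg1.
Qed.

Lemma homog_mulmx m p q e e' (A : 'M[S]_(m, p)) (B : 'M[S]_(p, q)) :
  homog_mx e A -> homog_mx e' B -> homog_mx (e + e') (A *m B).
Proof.
move=> hA hB i j; rewrite mxE; apply: rpred_sum => k _; exact: dhomogM.
Qed.

Section MatrixAction.
Variables (m p : nat) (M : 'M[S]_(m, p)) (n q : nat).

(** The target degree [q] is a free parameter, which avoids casts between equal degrees; the
    truncation is harmless when [q] is [n] plus the degree of [M]. *)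
Definition mxgr_fun (u : gr m n) : gr p q := gr_of q (row_of u *m M).

Fact mxgr_fun_linear : linear mxgr_fun.
Proof.
move=> c u v; apply/ffunP => j; apply: val_inj; rewrite !ffunE /=.
rewrite !mxE -linearZ -linearD /=; congr (pihomog _ _ _).
rewrite scaler_sumr -big_split; apply: eq_bigr => i _ /=.
by rewrite !mxE !ffunE /= mulrDl scalerAl.
Qed.

HB.instance Definition _ := GRing.isLinear.Build F (gr m n) (gr p q) _
  mxgr_fun mxgr_fun_linear.

Definition mxgr : 'Hom(gr m n, gr p q) := linfun mxgr_fun.

Lemma row_of_mxgr e u : homog_mx e M -> q = (n + e)%N ->
  row_of (mxgr u) = row_of u *m M.
Proof.
move=> hM eq_q; rewrite lfunE /= gr_ofK // eq_q.
by apply: homog_mulmx => //; exact: homog_row_of.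
Qed.

End MatrixAction.

Section VariableAction.
Variables (m : nat) (i : 'I_3) (n : nat).

Definition Xgr : 'Hom(gr m n, gr m n.+1) := mxgr ('X_i)%:M n n.+1.

Lemma row_of_Xgr u : row_of (Xgr u) = 'X_i *: row_of u.
Proof.
rewrite (@row_of_mxgr _ _ _ _ _ 1) ?mul_mx_scalar ?addn1 // => j k.
rewrite mxE; case: eqP => _; rewrite ?mulr1n ?mulr0n ?dhomog0 //.
by rewrite dhomogX /= mdeg1.
Qed.

Lemma Xgr_inj : lker Xgr = 0%VS.
Proof.
apply/eqP/lker0P => u v e; apply: row_of_inj; apply/rowP => j.
have /rowP/(_ j) := congr1 (@row_of _ _) e; rewrite !row_of_Xgr !mxE.
by apply: mulfI; exact: mpolyX_neq0.
Qed.

End VariableAction.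

Section Evaluation.
Variables (m n : nat).

Definition evgr_fun (u : gr m n) : 'rV[F]_m := map_mx (@evz F) (row_of u).

Fact evgr_fun_linear : linear evgr_fun.
Proof.
move=> c u v; apply/rowP => j.
by rewrite !mxE !ffunE /= /evz mevalD mevalZ.
Qed.

HB.instance Definition _ := GRing.isLinear.Build F (gr m n) 'rV[F]_m _
  evgr_fun evgr_fun_linear.

Definition evgr : 'Hom(gr m n, 'rV[F]_m) := linfun evgr_fun.

Lemma evgrE u : evgr u = map_mx (@evz F) (row_of u).
Proof. by rewrite lfunE. Qed.

End Evaluation.

Lemma dim_gr m n : \dim {:gr m n} = (m * 'C(n + 2, n))%N.
Proof.
rewrite dimvf /dim /= card_ord; congr (_ * _)%N.
Qed.

End GradedRows.

Notation gr F m n := {ffun 'I_m -> dhomog 3 F n}.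

(** * Relations between the syzygies *)

Section Relations.
Variables (F : fieldType) (m r D : nat).
Local Notation S := {mpoly F[3]}.
Variables (rho : 'M[S]_(m, 3)) (g : 'cV[S]_3).
Hypothesis rho_homog : homog_mx r rho.
Hypothesis g_homog : homog_mx D g.
Hypothesis rho_g : rho *m g = 0.
Hypothesis rho_gen : forall w : 'rV[S]_3, w *m g = 0 -> exists u, w = u *m rho.

Local Notation x := ('X_ord0 : S).
Local Notation y := ('X_(inord 1) : S).
Local Notation z := ('X_ord_max : S).

Definition relK n : {vspace gr F m n} := lker (mxgr rho n (n + r)).

Lemma mem_relK n (u : gr F m n) : (u \in relK n) = (row_of u *m rho == 0).
Proof.
rewrite memv_ker; apply/eqP/eqP => [u0|u0].
  by rewrite -(row_of_mxgr _ rho_homog (erefl (n + r)%N)) u0 row_of0.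
by apply: row_of_inj; rewrite (row_of_mxgr _ rho_homog) // u0 row_of0.
Qed.

Lemma gr_of_relK n (v : 'rV[S]_m) : v *m rho = 0 -> gr_of n v \in relK n.
Proof.
move=> v0; rewrite mem_relK row_of_gr_of -(hcomp_mulmx _ _ rho_homog) v0.
by apply/eqP/rowP => i; rewrite !mxE raddf0.
Qed.

Lemma scale_row_inj p (i : 'I_3) : injective (fun v : 'rV[S]_p => 'X_i *: v).
Proof.
move=> u v e; apply/rowP => j; have /rowP/(_ j) := e.
by rewrite !mxE; apply: mulfI; exact: mpolyX_neq0.
Qed.

Lemma koszul_row p (a b : 'rV[S]_p) : x *: a + y *: b = 0 ->
  exists c, a = y *: c /\ b = - (x *: c).
Proof.
move=> e; have ex (j : 'I_p) : exists c, a 0 j = y * c /\ b 0 j = - (x * c).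
  by apply: koszul_xy; have /rowP/(_ j) := e; rewrite !mxE.
have [c hc] := fin_all_exists ex.
by exists (\row_j c j); split; apply/rowP => j; rewrite !mxE; case: (hc j).
Qed.

Lemma mem_ideal_xy_row p n (v : 'rV[S]_p) : homog_mx n v ->
  (forall j, evz (v 0 j) = 0) -> exists a b, v = x *: a + y *: b.
Proof.
move=> hv v0.
have ex (j : 'I_p) : exists ab : S * S, v 0 j = x * ab.1 + y * ab.2.
  by have [a [b e]] := mem_ideal_xy (hv 0 j) (v0 j); exists (a, b).
have [ab hab] := fin_all_exists ex.
by exists (\row_j (ab j).1), (\row_j (ab j).2); apply/rowP => j; rewrite !mxE hab.
Qed.

(* If v = x a + y b, then x (a rho) + y (b rho) = 0 gives a rho = y c and
   b rho = - x c, where c is again a syzygy of g, hence c = u rho; subtract the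
   Koszul relation (y u, - x u) from (a, b). *)
Lemma relation_mod_xy n (v : 'rV[S]_m) : homog_mx n v -> v *m rho = 0 ->
  (forall j, evz (v 0 j) = 0) ->
  exists a b, [/\ a *m rho = 0, b *m rho = 0 & v = x *: a + y *: b].
Proof.
move=> hv v0 /(mem_ideal_xy_row hv) [a [b e]].
have /koszul_row [c [ea eb]] : x *: (a *m rho) + y *: (b *m rho) = 0.
  by rewrite !scalemxAl -mulmxDl -e.
have /rho_gen [u eu] : c *m g = 0.
  apply: (@scale_row_inj _ (inord 1)).
  by rewrite scaler0 scalemxAl -ea -mulmxA rho_g mulmx0.
exists (a - y *: u), (b + x *: u); split.
- by rewrite mulmxBl ea -scalemxAl -eu subrr.
- by rewrite mulmxDl eb -scalemxAl -eu addNr.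
rewrite scalerBr scalerDr e !scalerA [y * x]mulrC.
by rewrite addrACA addNr addr0.
Qed.

Lemma relK_mod_xy n (v : gr F m n.+1) : v \in relK n.+1 -> evgr F m n.+1 v = 0 ->
  exists2 a, a \in relK n & exists2 b, b \in relK n &
    v = Xgr F m ord0 n a + Xgr F m (inord 1) n b.
Proof.
rewrite mem_relK => /eqP v0 ev0.
have evz0 (j : 'I_m) : evz (row_of v 0 j) = 0.
  by have /rowP/(_ j) := ev0; rewrite evgrE !mxE.
have [a [b [a0 b0 e]]] := relation_mod_xy (homog_row_of v) v0 evz0.
exists (gr_of n a); first exact: gr_of_relK.
exists (gr_of n b); first exact: gr_of_relK.
apply: row_of_inj; rewrite row_ofD !row_of_Xgr !row_of_gr_of -!hcompZ -hcompD.
by rewrite -e hcomp_id //; exact: homog_row_of.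
Qed.

Lemma Xgr_relK i n (u : gr F m n) : (Xgr F m i n u \in relK n.+1) = (u \in relK n).
Proof.
rewrite !mem_relK row_of_Xgr -scalemxAl; apply/eqP/eqP => [e|->].
  by apply: (@scale_row_inj _ i); rewrite e scaler0.
by rewrite scaler0.
Qed.

Lemma evgr_Xgr i n (u : gr F m n) :
  evgr F m n.+1 (Xgr F m i n u) = (i == ord_max)%:R *: evgr F m n u.
Proof.
rewrite !evgrE row_of_Xgr; apply/rowP => j.
by rewrite !mxE /evz mevalM mevalXU.
Qed.

(* K/(x,y)K in degree n, as a subspace of the space of its coefficients of z^n. *)
Definition relW n : {vspace 'rV[F]_m} := (evgr F m n @: relK n)%VS.

Lemma relW_mono n : (relW n <= relW n.+1)%VS.
Proof.
apply/subvP => _ /memv_imgP [u Ku ->].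
have -> : evgr F m n u = evgr F m n.+1 (Xgr F m ord_max n u).
  by rewrite evgr_Xgr eqxx scale1r.
by apply: memv_img; rewrite Xgr_relK.
Qed.

Lemma ker_evgr n : (relK n.+1 :&: lker (evgr F m n.+1) =
  Xgr F m ord0 n @: relK n + Xgr F m (inord 1) n @: relK n)%VS.
Proof.
have ev0 i u : i != ord_max -> evgr F m n.+1 (Xgr F m i n u) = 0.
  by move=> /negbTE ne; rewrite evgr_Xgr ne scale0r.
apply: subv_anti; apply/andP; split; apply/subvP => v.
  rewrite memv_cap (memv_ker (evgr F m n.+1)) => /andP [Kv /eqP v0].
  have [a Ka [b Kb ->]] := relK_mod_xy Kv v0.
  by apply: memv_add; apply: memv_img.
case/memv_addP => _ /memv_imgP [a Ka ->] [_ /memv_imgP [b Kb ->] ->].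
rewrite memv_cap (memv_ker (evgr F m n.+1)) linearD /= !ev0 ?addr0 ?eqxx ?andbT ?memvD ?Xgr_relK //.
by rewrite -val_eqE /= inordK.
Qed.

(** Regularity of [x], [y] on the relations: [x a = y b] forces [a = y c], and [c] is again a
    relation because [y] can be cancelled. *)
Lemma cap_Xgr n : (Xgr F m ord0 n.+1 @: relK n.+1 :&: Xgr F m (inord 1) n.+1 @: relK n.+1
  = (Xgr F m ord0 n.+1 \o Xgr F m (inord 1) n)%VF @: relK n)%VS.
Proof.
apply: subv_anti; apply/andP; split; apply/subvP => v; last first.
  case/memv_imgP => u Ku ->; rewrite memv_cap comp_lfunE memv_img ?Xgr_relK //=.
  have -> : Xgr F m ord0 n.+1 (Xgr F m (inord 1) n u) = Xgr F m (inord 1) n.+1 (Xgr F m ord0 n u).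
    by apply: row_of_inj; rewrite !row_of_Xgr !scalerA mulrC.
  by rewrite memv_img ?Xgr_relK.
rewrite memv_cap => /andP [/memv_imgP [a Ka ->] /memv_imgP [b Kb e]].
have /koszul_row [c [ea _]] : x *: row_of a + y *: (- row_of b) = 0.
  by rewrite -row_of_Xgr e row_of_Xgr scalerN subrr.
have -> : a = Xgr F m (inord 1) n (gr_of n c).
  apply: row_of_inj; rewrite row_of_Xgr row_of_gr_of -hcompZ -ea hcomp_id //.
  exact: homog_row_of.
rewrite -comp_lfunE; apply: memv_img.
move: Ka; rewrite !mem_relK ea row_of_gr_of -(hcomp_mulmx _ _ rho_homog) -scalemxAl.
move=> /eqP e0; have -> : c *m rho = 0.
  by apply: (@scale_row_inj _ (inord 1)); rewrite e0 scaler0.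
by apply/eqP/rowP => i; rewrite !mxE raddf0.
Qed.

Lemma dim_Xgr_img i n (U : {vspace gr F m n}) : \dim (Xgr F m i n @: U) = \dim U.
Proof. by apply: limg_dim_eq; rewrite Xgr_inj capv0. Qed.

(** Rank-nullity for evaluation on [relK n.+2]: the kernel is a sum of two copies of [relK n.+1]
    meeting in a copy of [relK n]. *)
Lemma dim_relK_rec n :
  (\dim (relK n.+2) + \dim (relK n) = 2 * \dim (relK n.+1) + \dim (relW n.+2))%N.
Proof.
have e1 := limg_ker_dim (evgr F m n.+2) (relK n.+2).
have e2 := dimv_sum_cap (Xgr F m ord0 n.+1 @: relK n.+1) (Xgr F m (inord 1) n.+1 @: relK n.+1).
move: e1 e2; rewrite ker_evgr cap_Xgr limg_comp !dim_Xgr_img -/(relW n.+2).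
by move=> <- e; rewrite addnAC e mul2n addnn.
Qed.

Lemma dim_relK1 : relK 0 = 0%VS -> \dim (relK 1) = \dim (relW 1).
Proof.
move=> K0; apply/esym; apply: limg_dim_eq; rewrite ker_evgr K0 !limg0.
exact: addv0.
Qed.

Definition Jgr p : {vspace gr F 1 (p + D)} := limg (mxgr g p (p + D)).

(** The syzygies of [g] in degree [n + r] are the image of [rho], whose kernel is [relK n]; the two
    rank formulas are combined. *)
Lemma dim_Jgr n : (\dim (Jgr (n + r)) + m * 'C(n + 2, n) =
  3 * 'C(n + r + 2, n + r) + \dim (relK n))%N.
Proof.
have := limg_ker_dim (mxgr g (n + r) (n + r + D)) fullv.
have := limg_ker_dim (mxgr rho n (n + r)) fullv.
rewrite !capfv !dim_gr.
suff -> : lker (mxgr g (n + r) (n + r + D)) = limg (mxgr rho n (n + r)).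
  by move=> <- <-; rewrite /Jgr /relK addnCA addnC; congr (_ + _)%N; exact: addnC.
apply: subv_anti; apply/andP; split; apply/subvP => v.
  rewrite memv_ker => /eqP v0.
  have /rho_gen [u eu] : row_of v *m g = 0.
    by rewrite -(row_of_mxgr _ g_homog (erefl (n + r + D)%N)) v0 row_of0.
  have -> : v = mxgr rho n (n + r) (gr_of n u); last by rewrite memv_img ?memvf.
  apply: row_of_inj; rewrite (row_of_mxgr _ rho_homog) // row_of_gr_of.
  rewrite -(hcomp_mulmx _ _ rho_homog) -eu hcomp_id //; exact: homog_row_of.
case/memv_imgP => u _ ->; rewrite memv_ker; apply/eqP; apply: row_of_inj.
rewrite (row_of_mxgr _ g_homog) // (row_of_mxgr _ rho_homog) //.
by rewrite -mulmxA rho_g mulmx0 row_of0.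
Qed.

End Relations.

(** * Hilbert function arithmetic *)

Lemma bin_addn2S n : 'C(n.+1 + 2, n.+1) = ('C(n + 2, n) + n.+2)%N.
Proof. by rewrite addSn binS addnC; congr (_ + _)%N; rewrite addn2 binSn. Qed.

Lemma nonincr_eventually_const (h : nat -> nat) N :
  (forall n, (N <= n)%N -> (h n.+1 <= h n)%N) ->
  exists N', forall n, (N' <= n)%N -> h n = h N'.
Proof.
have [k] := ubnP (h N); elim: k N => // k IHk N ltk mono.
have le_hN n : (N <= n)%N -> (h n <= h N)%N.
  move/subnKC <-; elim: (n - N)%N => [|i IHi]; first by rewrite addn0.
  by rewrite addnS (leq_trans _ IHi) // mono // leq_addr.
have [[n [leNn lt_n]]|none] := classic (exists n, (N <= n)%N /\ (h n < h N)%N).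
  apply: (IHk n); first exact: leq_trans lt_n ltk.
  by move=> i le_ni; apply: mono; exact: leq_trans le_ni.
exists N => n leNn; apply/eqP; rewrite eqn_leq le_hN // leqNgt.
by apply/negP => lt_n; case: none; exists n.
Qed.

(** Here [k] and [w] stand for the dimensions of K_n and W_n, and [h] for that of M(f) in degree
    [n + r + D]. Once [h] is constant its first difference fixes the growth of [k], and monotonicity
    of [w] carries this down to small [n]. *)
Lemma hilbert_arithmetic (m r D N : nat) (w k h : nat -> nat) :
  (3 < m)%N -> (2 * r + 1 = D + m)%N ->
  k 0%N = 0%N -> k 1%N = w 1%N ->
  (forall n, k n.+2 + k n = 2 * k n.+1 + w n.+2)%N ->
  (forall n, w n <= w n.+1)%N ->
  (forall n, h n + 3 * 'C(n + r + 2, n + r) + k n =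
     'C(n + r + D + 2, n + r + D) + m * 'C(n + 2, n))%N ->
  (forall n, (N <= n)%N -> (h n.+1 <= h n)%N) ->
  [/\ w 1%N = (m - 3)%N, forall n, w n.+2 = (m - 2)%N &
      forall n, k n.+1 = (k n + (m - 3) + (m - 2) * n)%N].
Proof.
move=> m3; have [M em] : exists M, m = (M + 2)%N by exists (m - 2)%N; lia.
have -> : (m - 2 = M)%N by lia.
have -> : (m - 3 = M - 1)%N by lia.
rewrite {}em in m3 * => rDm k0 k1 kS w_mono hE h_mono.
(* First difference of [hE]. The relation between [r], [D] and [m] eliminates [r] and [D]: [h] grows
   by [M n + M - 1] minus the growth of [k]. *)
have dE n : (h n.+1 + k n.+1 + (M + 2) = h n + k n + M * n + (2 * M + 1))%N.
  move: (hE n) (hE n.+1); rewrite (addSn n r) (addSn (n + r) D) !bin_addn2S.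
  move: 'C(_, _) 'C(_, _) 'C(_, _) => c1 c2 c3; nia.
have [N1 h_const] := nonincr_eventually_const h_mono.
have kE n : (N1 <= n)%N -> (k n.+1 + (M + 2) = k n + M * n + (2 * M + 1))%N.
  move=> leN; have := dE n; rewrite (h_const n) // (h_const n.+1); last exact: leqW.
  lia.
(* The second difference of [k], which is [w n.+2], equals the slope [M]. *)
have w_large n : (N1 <= n)%N -> w n.+2 = M%N.
  move=> leN; move: (kE n leN) (kE n.+1 (leqW leN)) (kS n); nia.
have w_le i n : (i <= n)%N -> (w i <= w n)%N.
  move/subnKC <-; elim: (n - i)%N => [|j IHj]; first by rewrite addn0.
  by rewrite addnS (leq_trans IHj).
have w_max n : (w n <= M)%N.
  rewrite -(w_large (maxn N1 n)) ?leq_maxl // w_le //; lia.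
(* [a n] is the accumulated defect: sum of [M - w j] over [2 <= j <= n + 1]. *)
pose a n := (M * n + w 1 + k n - k n.+1)%N.
have aE n : (M * n + w 1 + k n = k n.+1 + a n)%N /\ (a n <= a n.+1)%N.
  rewrite /a; elim: n => [|n [IHn _]].
    move: (kS 0%N) (w_max 2%N); rewrite k0 k1; lia.
  by move: (kS n) (kS n.+1) (w_max n.+2) (w_max n.+3) IHn; nia.
have a_mono i n : (i <= n)%N -> (a i <= a n)%N.
  move/subnKC <-; elim: (n - i)%N => [|j IHj]; first by rewrite addn0.
  by rewrite addnS (leq_trans IHj) //; case: (aE (i + j)%N).
(* For large [n] the defect is [w 1 - (M - 1)], hence [w 1] is at least [M - 1]. *)
have aN n : (N1 <= n)%N -> (a n + (M + 2) = w 1 + 3)%N.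
  by move=> leN; have [+ _] := aE n; have := kE n leN; nia.
have w1 : w 1%N = (M - 1)%N.
  have aNN := aN N1 (leqnn _).
  have [lt_w1|] := ltnP (w 1%N) M; first by lia.
  (* If [w 1] were [M], every later [w n] would be [M] and the defect 0, whereas [aN] gives 1. *)
  move=> ge_w1; suff : a N1 = 0%N by have := w_max 1%N; lia.
  have wn n : w n.+1 = M%N.
    by apply/eqP; rewrite eqn_leq w_max (leq_trans ge_w1) // w_le.
  elim: {aNN h_const kE w_large aN} N1 => [|n IHn]; first by rewrite /a k0 k1; lia.
  by move: (kS n) (wn n.+1) (aE n) (aE n.+1); nia.
have a0 n : a n = 0%N.
  have := aN (maxn N1 n) (leq_maxl _ _); rewrite w1.
  by have := a_mono n (maxn N1 n) (leq_maxr _ _); lia.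
have kdiff n : k n.+1 = (k n + (M - 1) + M * n)%N.
  by have [] := aE n; rewrite a0; lia.
split=> // n; move: (kS n) (kdiff n) (kdiff n.+1); nia.
Qed.

(** * A basis of the module of relations *)

Section Basis.
Variables (F : fieldType) (m r : nat).
Local Notation S := {mpoly F[3]}.
Variables (rho : 'M[S]_(m, 3)) (g : 'cV[S]_3).
Hypothesis rho_homog : homog_mx r rho.
Hypothesis rho_g : rho *m g = 0.
Hypothesis rho_gen : forall w : 'rV[S]_3, w *m g = 0 -> exists u, w = u *m rho.
Local Notation K := (relK r rho).
Local Notation W := (relW r rho).

Definition in_span t (b : 'I_t -> 'rV[S]_m) (v : 'rV[S]_m) :=
  exists a : 'I_t -> S, v = \sum_j a j *: b j.

Section InSpan.
Variables (t : nat) (b : 'I_t -> 'rV[S]_m).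

Lemma in_span0 : in_span b 0.
Proof. by exists (fun=> 0); rewrite big1 // => j _; rewrite scale0r. Qed.

Lemma in_spanD u v : in_span b u -> in_span b v -> in_span b (u + v).
Proof.
move=> [c ->] [c' ->]; exists (fun j => c j + c' j); rewrite -big_split.
by apply: eq_bigr => j _; rewrite scalerDl.
Qed.

Lemma in_spanZ c v : in_span b v -> in_span b (c *: v).
Proof.
move=> [c' ->]; exists (fun j => c * c' j); rewrite scaler_sumr.
by apply: eq_bigr => j _; rewrite scalerA.
Qed.

Lemma in_span_gen j : in_span b (b j).
Proof.
exists (fun i => (i == j)%:R); rewrite (bigD1 j) //= eqxx scale1r.
by rewrite big1 ?addr0 // => i /negbTE ->; rewrite scale0r.
Qed.

End InSpan.

Lemma hcomp_sum n (v : 'rV[S]_n) : exists k, v = \sum_(d < k) hcomp d v.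
Proof.
have [k hk] : exists k, forall i, (mmeasure mdeg (v 0%R i) <= k)%N.
  by exists (\max_i mmeasure mdeg (v 0%R i))%N => i; exact: leq_bigmax.
exists k; apply/rowP => i; rewrite summxE [LHS](pihomog_partitionE (hk i)).
by apply: eq_bigr => d _; rewrite mxE.
Qed.

(** Evaluation at (0,0,1) turns polynomial coefficients into scalars, so the values of the [t]
    generators span a space containing each [W n]. *)
Lemma relations_rank t (h : 'I_t -> 'rV[S]_m) n :
  (forall v, v *m rho = 0 -> in_span h v) -> (\dim (W n) <= t)%N.
Proof.
move=> gen; pose X := [tuple map_mx (@evz F) (h j) | j < t].
suff sW : (W n <= <<X>>)%VS.
  by rewrite (leq_trans (dimvS sW)) // (leq_trans (dim_span _)) // size_tuple.
apply/subvP => _ /memv_imgP [u Ku ->].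
move: Ku; rewrite (mem_relK rho_homog) => /eqP /gen [a e].
have -> : evgr F m n u = \sum_j evz (a j) *: map_mx (@evz F) (h j).
  rewrite evgrE e; apply/rowP => i; rewrite mxE !summxE /evz raddf_sum.
  by apply: eq_bigr => j _; rewrite !mxE /= mevalM.
apply: memv_suml => j _; apply/memvZ/memv_span/tnthP.
by exists j; rewrite tnth_mktuple.
Qed.

Hypothesis K0 : K 0 = 0%VS.
Hypothesis m_gt3 : (3 < m)%N.
Hypothesis dimW1 : \dim (W 1) = (m - 3)%N.
Hypothesis dimW2 : forall n, \dim (W n.+2) = (m - 2)%N.

Lemma relW_stable n : W n.+2 = W 2.
Proof.
elim: n => // n <-; apply/esym/eqP.
by rewrite eqEdim !dimW2 leqnn andbT; exact: relW_mono.
Qed.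

(** The generators are a basis of [K 1] and one [c] in [K 2] whose value at (0,0,1) is outside
    [W 1]. By induction on the degree: a relation minus a combination of generators with the same
    value is [x] and [y] times relations of lower degree. *)
Lemma relations_basis : exists b : 'I_(m - 2) -> 'rV[S]_m,
  [/\ forall j, b j *m rho = 0,
      forall v, v *m rho = 0 -> in_span b v,
      forall j : 'I_(m - 2), (j < m - 3)%N -> homog_mx 1 (b j) &
      forall j : 'I_(m - 2), j = (m - 3)%N :> nat -> homog_mx 2 (b j)].
Proof.
have dimK1 : \dim (K 1) = (m - 3)%N.
  by rewrite -dimW1; exact: dim_relK1 rho_homog rho_g rho_gen K0.
have [c Kc W2E] : exists2 c, c \in K 2 & (W 2 <= W 1 + <[evgr F m 2 c]>)%VS.
  have /subvPn [_ /memv_imgP [c Kc ->] nW1] : ~~ (W 2 <= W 1)%VS.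
    by apply: contraL (m_gt3) => /dimvS; rewrite dimW1 dimW2; lia.
  exists c => //.
  have sub : (W 1 + <[evgr F m 2 c]> <= W 2)%VS.
    rewrite subv_add relW_mono //= -memvE; exact: memv_img.
  have [_ e] := dimv_leqif_eq sub.
  suff /eqP <- : (W 1 + <[evgr F m 2 c]> == W 2)%VS by exact: subvv.
  rewrite -e; rewrite dimv_disjoint_sum ?dimW1 ?dimW2 ?dim_vline.
    have -> : evgr F m 2 c != 0 by apply: contraNneq nW1 => ->; rewrite mem0v.
    by apply/eqP; lia.
  apply/eqP; rewrite -subv0; apply/subvP => v; rewrite memv_cap => /andP[vW1].
  case/vlineP => a e'; move: vW1; rewrite e'; have [->|a0] := eqVneq a 0.
    by rewrite scale0r memv0 eqxx.
  by rewrite rpredZeq (negbTE a0) (negbTE nW1).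
(* The last index, [m - 3], carries the relation of degree 2. *)
pose b (j : 'I_(m - 2)) : 'rV[S]_m :=
  if (j < m - 3)%N then row_of (vbasis (K 1))`_j else row_of c.
have spanP n (u v : gr F m n) a : in_span b (row_of u) -> in_span b (row_of v) ->
    in_span b (row_of (a *: u + v)).
  by move=> hu hv; rewrite row_ofD row_ofZ; apply: in_spanD => //; exact: in_spanZ.
have span1 u : u \in K 1 -> in_span b (row_of u).
  move=> /coord_vbasis ->; elim/big_ind: _ => [|u1 u2 h1 h2|i _].
  - by rewrite row_of0; exact: in_span0.
  - by rewrite row_ofD; exact: in_spanD.
  rewrite row_ofZ; apply: in_spanZ.
  have lt_i : (i < m - 3)%N by rewrite -dimK1.
  have lt_i' : (i < m - 2)%N by lia.
  by have := in_span_gen b (Ordinal lt_i'); rewrite {2}/b /= lt_i.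
have spanc : in_span b (row_of c).
  have lt_j : (m - 3 < m - 2)%N by lia.
  by have := in_span_gen b (Ordinal lt_j); rewrite {2}/b /= ltnn.
(* Values in [W 2] are lifted to all higher degrees by multiplying by the third variable, which is 1
   at (0,0,1). *)
have lift n w : w \in W 2 ->
    exists2 u, u \in K n.+2 & evgr F m n.+2 u = w /\ in_span b (row_of u).
  move=> Ww; elim: n => [|n [u Ku [eu su]]].
    have /memv_addP [_ /memv_imgP [b1 Kb1 ->] [_ /vlineP [a ->] ew]] := subvP W2E _ Ww.
    exists (a *: c + Xgr F m ord_max 1 b1).
      by rewrite memvD ?memvZ // Xgr_relK.
    split; first by rewrite linearP /= evgr_Xgr eqxx scale1r addrC ew.
    by apply: spanP => //; rewrite row_of_Xgr; apply: in_spanZ; exact: span1.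
  exists (Xgr F m ord_max n.+2 u); first by rewrite Xgr_relK.
  split; first by rewrite evgr_Xgr eqxx scale1r.
  by rewrite row_of_Xgr; exact: in_spanZ.
have spanK n u : u \in K n -> in_span b (row_of u).
  elim: n u => [|[|n] IHn] u; [|exact: span1|].
    by rewrite K0 memv0 => /eqP ->; rewrite row_of0; exact: in_span0.
  move=> Ku; have Wu : evgr F m n.+2 u \in W 2 by rewrite -(relW_stable n) memv_img.
  have [u' Ku' [eu' su']] := lift n _ Wu.
  have [] := relK_mod_xy rho_homog rho_g rho_gen (memvB Ku Ku').
    by rewrite linearB /= eu' subrr.
  move=> u1 Ku1 [u2 Ku2 eu].
  rewrite -(subrK u' u) eu !row_ofD !row_of_Xgr.
  by do 2![apply: in_spanD => //]; apply: in_spanZ; exact: IHn.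
exists b; split=> [j|v v0|j lt_j|j ej].
- rewrite /b; case: ifP => lt_j; apply/eqP; rewrite -(mem_relK rho_homog) //.
  by rewrite vbasis_mem // mem_nth // size_tuple dimK1.
(* An arbitrary relation is the sum of its homogeneous components, each of which is a relation. *)
- have [k ->] := hcomp_sum v; elim/big_ind: _ => [|v1 v2|d _].
  + exact: in_span0.
  + exact: in_spanD.
  by rewrite -row_of_gr_of; apply: spanK; exact: gr_of_relK.
- by rewrite /b lt_j; exact: homog_row_of.
by rewrite /b ej ltnn; exact: homog_row_of.
Qed.

End Basis.

(** * Nonvanishing, chain rule and Euler relation *)

Lemma mpoly_ring_ind n (R : comNzRingType) (P : {mpoly R[n]} -> Prop) :
  (forall c, P c%:MP) -> (forall i, P 'X_i) ->
  (forall p q, P p -> P q -> P (p + q)) ->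
  (forall p q, P p -> P q -> P (p * q)) -> forall p, P p.
Proof.
move=> PC PX PD PM; elim/mpolyind => [|c m p _ _ Pp].
  by rewrite -(mpolyC0 n R).
apply: PD => //; rewrite -mul_mpolyC; apply: (PM) => //.
rewrite mpolyXE_id; apply: (big_ind P) => [||i _]; first by rewrite -mpolyC1.
  exact: PM.
elim: (m i) => [|k IHk]; first by rewrite expr0 -mpolyC1.
by rewrite exprS; apply: PM.
Qed.

(** Induction on the number of variables: view [p] as univariate in the last one, choose a point
    where its leading coefficient is nonzero, then a nonroot of the specialisation. *)
Lemma mpoly_nonroot (F : closedFieldType) n (p : {mpoly F[n]}) :
  p != 0 -> exists v, p.@[v] != 0.
Proof.
elim: n p => [|n IHn] p p0.
  exists (fun=> 0); apply: contraNneq p0 => p0; apply/eqP.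
  rewrite -(mmap_mpolyC_id p) -(mpolyC0 0 F) -p0 /meval (rmorph_mmap (@mpolyC 0 F)).
  by apply: eq_mmap => -[].
pose X (i : 'I_n.+1) : {poly {mpoly F[n]}} :=
  if unlift ord_max i is Some j then ('X_j)%:P else 'X.
pose U := mmap (polyC \o @mpolyC n F) X.
have U0 : U p != 0.
  apply: contraNneq p0 => p0.
  (* [inv] substitutes the last variable back, so [U p = 0] forces [p = 0]. *)
  pose inv : {rmorphism {poly {mpoly F[n]}} -> {mpoly F[n.+1]}} :=
    horner_eval ('X_ord_max : {mpoly F[n.+1]}) \o map_poly (@mwiden n F).
  have : inv (U p) = 0 by rewrite p0 rmorph0.
  rewrite rmorph_mmap -[X in _ -> X == 0]mmap_mpolyC_id => <-; apply/eqP.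
  apply: eq_bigr => m _; congr (_ * _).
    by rewrite /= map_polyC /horner_eval hornerC /= mwidenC.
  apply: mmap1_eq => i; rewrite /= /X; case: unliftP => [j ->|->].
    rewrite map_polyC /horner_eval hornerC /= mwidenX; congr 'X_[_].
    apply/mnmP => l; rewrite mnmwiden1 !mnm1E; congr (nat_of_bool (_ == _)).
    by apply: val_inj; rewrite /= /bump leqNgt ltn_ord.
  by rewrite map_polyX /horner_eval hornerX.
have [v lv] : exists v, (lead_coef (U p)).@[v] != 0.
  by apply: IHn; rewrite lead_coef_eq0.
have /closed_nonrootP [t] : map_poly (meval v) (U p) != 0.
  apply: contraNneq lv => /(congr1 (fun q : {poly F} => q`_(size (U p)).-1)).
  by rewrite coef_map coef0 => ->.
rewrite /root -horner_evalE => ht.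
exists (fun i => if unlift ord_max i is Some j then v j else t).
apply: contraNneq ht => e; apply/eqP; rewrite -[RHS]e {e}.
pose ev : {rmorphism {poly {mpoly F[n]}} -> F} := horner_eval t \o map_poly (meval v).
rewrite -[horner_eval t _]/(ev (U p)) rmorph_mmap.
apply: eq_bigr => m _; congr (_ * _).
  by rewrite /= map_polyC /horner_eval hornerC /= mevalC.
apply: mmap1_eq => i; rewrite /= /X; case: unliftP => [j _|_].
  by rewrite map_polyC /horner_eval hornerC /= mevalXU.
by rewrite map_polyX /horner_eval hornerX.
Qed.

Lemma deriv_mmap n (R : comNzRingType) (h : 'I_n -> {poly R}) (p : {mpoly R[n]}) :
  (mmap polyC h p)^`() = \sum_l (h l)^`() * mmap polyC h p^`M(l).
Proof.
elim/mpoly_ring_ind: p => [c|i|p q IHp IHq|p q IHp IHq].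
- rewrite mmapC derivC big1 // => l _.
  by rewrite mderivC mmap0 mulr0.
- rewrite mmapX mmap1U (bigD1 i) //= mderivX mnm1E eqxx scale1r.
  have -> : (U_(i) - U_(i) = 0 :> 'X_{1..n})%MM by apply/mnmP => k; rewrite mnmBE subnn mnm0E.
  rewrite mmapX mmap11 mulr1 big1 ?addr0 // => l ne.
  by rewrite mderivX mnm1E eq_sym (negbTE ne) scale0r mmap0 mulr0.
- rewrite mmapD derivD IHp IHq -big_split; apply: eq_bigr => l _ /=.
  by rewrite mderivD mmapD mulrDr.
rewrite rmorphM derivM IHp IHq mulr_suml mulr_sumr -big_split.
apply: eq_bigr => l _ /=; rewrite mderivM mmapD !rmorphM /=; ring.
Qed.

Lemma euler_homog n (R : comNzRingType) d (p : {mpoly R[n]}) : p \is d.-homog ->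
  \sum_l 'X_l * p^`M(l) = p *+ d.
Proof.
move=> /dhomogP hp; rewrite {2}[p]mpolyE -sumrMnl.
rewrite (eq_bigr (fun l => \sum_(m <- msupp p) (m l)%:R *: (p@_m *: 'X_[m]))).
  rewrite exchange_big /= big_seq [RHS]big_seq; apply: eq_bigr => m /hp e.
  have {e} <- : mdeg m = d by [].
  by rewrite -scaler_suml mdegE -natr_sum scaler_nat.
move=> l _; rewrite {1}[p]mpolyE raddf_sum mulr_sumr; apply: eq_bigr => m _ /=.
rewrite mderivZ mderivX -!scalerAr scalerA [_ * (m l)%:R]mulrC -scalerA.
have [->|m_gt0] := posnP (m l); first by rewrite !scale0r.
congr (_ *: (_ *: _)); rewrite -mpolyXD addmC submK //.
by apply/mnm_lepP => i; rewrite mnm1E; case: eqP => [<-|].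
Qed.

(** * Linear forms as prime elements *)

Section LinearForms.
Variables (F : fieldType) (n : nat).
Local Notation S := {mpoly F[n]}.

Definition lf (c : 'I_n -> F) : S := \sum_l (c l)%:MP * 'X_l.

Lemma lf_homog c : lf c \is 1.-homog.
Proof.
apply: rpred_sum => l _; rewrite mul_mpolyC; apply: dhomogZ.
by rewrite dhomogX /= mdeg1.
Qed.

Lemma lf_mmap (T : comNzRingType) (k : {rmorphism F -> T}) h c :
  mmap k h (lf c) = \sum_l k (c l) * h l.
Proof.
rewrite raddf_sum; apply: eq_bigr => l _.
by rewrite /= mul_mpolyC mmapZ mmapX mmap1U.
Qed.

Lemma lf_eval c v : (lf c).@[v] = \sum_l c l * v l.
Proof. exact: (@lf_mmap _ idfun). Qed.

Lemma lf_neq0 c l : c l != 0 -> lf c != 0.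
Proof.
apply: contraNneq => /(congr1 (meval (fun i => (i == l)%:R))) /eqP.
rewrite lf_eval meval0 (bigD1 l) //= eqxx mulr1 big1 ?addr0 // => i /negbTE ->.
by rewrite mulr0.
Qed.

Lemma lf_prime c l (p q u : S) : c l != 0 -> p * q = lf c * u ->
  (exists p', p = lf c * p') \/ (exists q', q = lf c * q').
Proof.
move=> cl0; set L := lf c.
(* A point at which [L] takes the value 1. *)
pose v i : F := if i == l then (c l)^-1 else 0.
pose sigma := mmap (@mpolyC n F) (fun i => 'X_i - (v i)%:MP * L).
have sigmaL : sigma L = 0.
  rewrite /sigma lf_mmap; under eq_bigr do rewrite mulrBr mulrA -mpolyCM.
  rewrite sumrB -/(lf c) -mulr_suml (bigD1 l) //= /v eqxx mulfV // mpolyC1.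
  rewrite big1 ?addr0 ?mul1r ?subrr // => i /negbTE ->.
  by rewrite mulr0.
have dvd w : sigma w = 0 -> exists w', w = L * w'.
  move=> w0; have [c' e] := mmap_sub_ideal (@mpolyC n F) (fun i => 'X_i : S)
    (fun i => 'X_i - (v i)%:MP * L) w.
  exists (\sum_i c' i * (v i)%:MP); move: e; rewrite -/(sigma w) w0 subr0.
  rewrite mmap_mpolyC_id mulr_sumr => ->.
  by apply: eq_bigr => i _; rewrite subKr; ring.
have sigmaM : {morph sigma : a b / a * b} by move=> a b; exact: rmorphM.
move=> /(congr1 sigma)/eqP; rewrite !sigmaM sigmaL mul0r mulf_eq0 => /orP [] /eqP w0; [left|right]; exact: dvd.
Qed.

Definition prime_elt (L : S) : Prop := L != 0 /\
  forall p q u, p * q = L * u ->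
  (exists p', p = L * p') \/ (exists q', q = L * q').

(* Gauss' lemma for a denominator that is a product of primes. *)
Lemma prime_cancel_square (Ls : seq S) (f p u : S) :
  (forall L, L \in Ls -> prime_elt L) -> (\prod_(L <- Ls) L) * f = p * p * u ->
  exists p' u' (Ms : seq S), [/\ f = p' * p' * u',
    {subset Ms <= Ls} & p = (\prod_(L <- Ms) L) * p'].
Proof.
elim: Ls p u => [|L Ls IH] p u prL; first rewrite big_nil mul1r => ->.
  by exists p, u, [::]; rewrite big_nil mul1r.
have [L0 Lpr] := prL L (mem_head _ _).
have {}prL M : M \in Ls -> prime_elt M by move=> MLs; apply: prL; rewrite inE MLs orbT.
have sub : {subset Ls <= L :: Ls} by move=> M MLs; rewrite inE MLs orbT.
rewrite big_cons -mulrA => e.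
have [[p1 ep]|[u1 eu]] : (exists p', p = L * p') \/ (exists u', u = L * u').
  by case: (Lpr _ _ _ (esym e)) => [[w /Lpr[]]|]; auto.
- have {}e : (\prod_(L <- Ls) L) * f = p1 * p1 * (L * u).
    by apply: (mulfI L0); rewrite e ep; ring.
  have [p' [u' [Ms [ef sM ep1]]]] := IH _ _ prL e.
  exists p', u', (L :: Ms); split => //; last by rewrite big_cons ep ep1 mulrA.
  by move=> M; rewrite !inE => /orP [->|/sM ->] //; rewrite orbT.
have {}e : (\prod_(L <- Ls) L) * f = p * p * u1.
  by apply: (mulfI L0); rewrite e eu; ring.
have [p' [u' [Ms [ef sM ep]]]] := IH _ _ prL e; exists p', u', Ms; split => //.
by move=> M /sM /sub.
Qed.

End LinearForms.

(** * An affine chart of the plane *)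

Section Chart.
Variables (F : numClosedFieldType) (a : 'I_3 -> F) (i j k : 'I_3).
Hypothesis ai0 : a i != 0.
Hypotheses (ji : j != i) (ki : k != i) (kj : k != j).
Local Notation S := {mpoly F[3]}.

Lemma ord3_cases l : [\/ l = i, l = j | l = k].
Proof.
case: (eqVneq l i) => [->|li]; first by constructor 1.
case: (eqVneq l j) => [->|lj]; first by constructor 2.
case: (eqVneq l k) => [->|lk]; first by constructor 3.
have : uniq [:: l; i; j; k].
  by rewrite /= !inE !negb_or li lj lk !(eq_sym i) !(eq_sym j k) ji ki kj.
by move/card_uniqP => /= e; have := max_card (mem [:: l; i; j; k]); rewrite e card_ord.
Qed.

Lemma sum_ijk (V : nmodType) (h : 'I_3 -> V) : \sum_l h l = h i + h j + h k.
Proof.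
rewrite (bigD1 i) //= (bigD1 j) ?ji //= (bigD1 k) ?ki //= big1 ?addr0 ?addrA //.
by move=> l /andP [/andP [l1 l2] l3]; case: (ord3_cases l) l1 l2 l3 => ->; rewrite eqxx.
Qed.

(* Coefficients of the linear forms dual to the basis a, e_j, e_k of F^3. *)
Definition c1 l : F := (l == i)%:R / a i.
Definition c0 l : F := (l == j)%:R - a j / a i * (l == i)%:R.
Definition c2 l : F := (l == k)%:R - a k / a i * (l == i)%:R.

Let ij : (i == j) = false. Proof. by rewrite eq_sym; apply: negbTE. Qed.
Let ik : (i == k) = false. Proof. by rewrite eq_sym; apply: negbTE. Qed.
Let jk : (j == k) = false. Proof. by rewrite eq_sym; apply: negbTE. Qed.
Let deltaE := (eqxx, ij, ik, jk, negbTE ji, negbTE ki, negbTE kj).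

Lemma lf_c1 (T : comNzRingType) (q : {rmorphism F -> T}) h :
  mmap q h (lf c1) = q (a i)^-1 * h i.
Proof.
by rewrite lf_mmap sum_ijk /c1 !deltaE /= !mul0r rmorph0 !mul0r !addr0 mul1r.
Qed.

Lemma lf_c0 (T : comNzRingType) (q : {rmorphism F -> T}) h :
  mmap q h (lf c0) = h j - q (a j / a i) * h i.
Proof.
rewrite lf_mmap sum_ijk /c0 !deltaE /= !mulr0 !subr0 !mulr1 rmorph1 rmorph0.
by rewrite rmorphB rmorph0; ring.
Qed.

Lemma lf_c2 (T : comNzRingType) (q : {rmorphism F -> T}) h :
  mmap q h (lf c2) = h k - q (a k / a i) * h i.
Proof.
rewrite lf_mmap sum_ijk /c2 !deltaE /= !mulr0 !subr0 !mulr1 rmorph1 rmorph0.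
by rewrite rmorphB rmorph0; ring.
Qed.

Lemma dual_basis (T : comNzRingType) (q : {rmorphism F -> T}) h l :
  h l = q (a l) * mmap q h (lf c1) + (l == j)%:R * mmap q h (lf c0)
      + (l == k)%:R * mmap q h (lf c2).
Proof.
have qi : q (a i) * q (a i)^-1 = 1 by rewrite -rmorphM mulfV // rmorph1.
rewrite lf_c1 lf_c0 lf_c2; case: (ord3_cases l) => ->; rewrite !deltaE /=.
- by rewrite mulrA qi; ring.
- by rewrite !rmorphM; ring.
by rewrite !rmorphM; ring.
Qed.

(* The affine chart s a + e_j + y e_k, as polynomials in s over F[y]. *)
Definition chart l : {poly {poly F}} :=
  (a l)%:P%:P * 'X + (l == j)%:R + (l == k)%:R * 'X%:P.

Definition phi : S -> {poly {poly F}} := mmap (polyC \o polyC) chart.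

Lemma chartE : [/\ chart i = (a i)%:P%:P * 'X, chart j = (a j)%:P%:P * 'X + 1
  & chart k = (a k)%:P%:P * 'X + 'X%:P].
Proof. by rewrite /chart !deltaE /=; split; ring. Qed.

Lemma phi_lf : [/\ phi (lf c1) = 'X, phi (lf c0) = 1 & phi (lf c2) = 'X%:P].
Proof.
have [e1 e2 e3] := chartE.
have P (u : F) : (u / a i)%:P%:P * (a i)%:P%:P = u%:P%:P :> {poly {poly F}}.
  by rewrite -!polyCM divfK.
rewrite /phi lf_c1 lf_c0 lf_c2 e1 e2 e3 /=; split.
- by rewrite mulrA -!polyCM mulVf // mul1r.
- by rewrite mulrA P; ring.
by rewrite mulrA P; ring.
Qed.

Lemma phiM : {morph phi : u v / u * v}. Proof. exact: rmorphM. Qed.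
Lemma phiB : {morph phi : u v / u - v}. Proof. exact: raddfB. Qed.
Lemma phiD : {morph phi : u v / u + v}. Proof. exact: raddfD. Qed.
Lemma phiC c : phi c%:MP = c%:P%:P. Proof. exact: mmapC. Qed.

(** The two equations say that [v] is the chart point with parameters [s], [y], scaled by the value
    of [lf c0] at [v]. *)
Lemma eval_lf_homog n (p : S) s y (v : 'I_3 -> F) : p \is n.-homog ->
  (lf c1).@[v] = (lf c0).@[v] * s -> (lf c2).@[v] = (lf c0).@[v] * y ->
  p.@[v] = (lf c0).@[v] ^+ n *
    p.@[fun l => a l * s + (l == j)%:R + (l == k)%:R * y].
Proof.
move=> hp e1 e2; rewrite /meval -(mmap_homogZ _ _ _ hp); apply: eq_mmap => l.
rewrite [LHS](dual_basis idfun) /= -/(meval v _) -/(meval v _) -/(meval v _) e1 e2.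
by rewrite /=; ring.
Qed.

(** If [p] is nonzero, [lf c0 * p] is nonzero at some point; after scaling, that point lies in the
    chart, where [phi p] computes [p]. *)
Lemma phi_inj n (p : S) : p \is n.-homog -> phi p = 0 -> p = 0.
Proof.
move=> hp p0; apply/eqP; have l0 : lf c0 != 0.
  by apply: (@lf_neq0 _ _ _ j); rewrite /c0 !deltaE mulr0 subr0 oner_eq0.
apply: contraNT (l0) => pn0; have /mpoly_nonroot [v] : lf c0 * p != 0.
  by rewrite mulf_neq0.
rewrite mevalM mulf_eq0 => /norP [v0].
rewrite (eval_lf_homog (s := (lf c1).@[v] / (lf c0).@[v])
  (y := (lf c2).@[v] / (lf c0).@[v]) hp) ?[_ * (_ / _)]mulrC ?divfK //.
set s := _ / _; set y := _ / _.
pose ev : {rmorphism {poly {poly F}} -> F} := horner_eval y \o horner_eval s%:P.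
suff <- : ev (phi p) = p.@[fun l => a l * s + (l == j)%:R + (l == k)%:R * y].
  by rewrite p0 rmorph0 mulr0 eqxx.
rewrite /phi rmorph_mmap; apply: eq_bigr => m _; congr (_ * _).
  by rewrite /= /horner_eval !hornerC.
apply: mmap1_eq => l; rewrite /= /chart /horner_eval !(hornerD, hornerM, hornerC, hornerX).
by case: (l == j); case: (l == k); rewrite /= ?(hornerC, hornerX, mul0r, mul1r, hornerM).
Qed.

(** Homogenisation: [phi] sends [lf c0] to 1, so its powers raise the degree without changing the
    image. *)
Lemma phi_surj (u : {poly {poly F}}) : exists N, forall n, (N <= n)%N ->
  exists2 p : S, p \is n.-homog & phi p = u.
Proof.
have [e1 e0 e2] := phi_lf.
pose H u := exists N, forall n, (N <= n)%N -> exists2 p : S, p \is n.-homog & phi p = u.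
have HD v w : H v -> H w -> H (v + w).
  move=> [N hN] [N' hN']; exists (maxn N N') => n; rewrite geq_max => /andP[ln ln'].
  have [p hp <-] := hN n ln; have [q hq <-] := hN' n ln'.
  by exists (p + q); [exact: rpredD | exact: phiD].
have HM v w (q : S) : q \is 1.-homog -> phi q = w -> H v -> H (v * w).
  move=> hq <- [N hN]; exists N.+1 => -[//|n] ln; have [p hp <-] := hN n ln.
  by exists (p * q); [rewrite -[n.+1]addn1; exact: dhomogM | exact: phiM].
have HC c : H c%:P%:P.
  exists 0%N => n _; exists (c%:MP * lf c0 ^+ n).
    rewrite mul_mpolyC; apply: dhomogZ; have := dhomogMn n (lf_homog c0).
    by rewrite mul1n.
  elim: n => [|n IHn]; first by rewrite expr0 mulr1 phiC.
  by rewrite exprSr mulrA phiM e0 mulr1.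
rewrite -/(H u); elim/poly_ind: u => [|u c Hu].
  by rewrite -[0]/(0%:P) -[0 : {poly F}]/(0%:P).
apply: (HD); first by apply: (HM) Hu; [exact: (lf_homog c1) | exact: e1].
elim/poly_ind: c => [|c y Hc]; first by rewrite -[0 : {poly F}]/(0%:P).
rewrite polyCD polyCM; apply: (HD) => //.
by apply: HM Hc; [exact: (lf_homog c2) | exact: e2].
Qed.

End Chart.

(** * A transversal line *)

Lemma prod_homog1 n (R : idomainType) (Ls : seq {mpoly R[n]}) :
  (forall L, L \in Ls -> L \is 1.-homog) -> \prod_(L <- Ls) L \is (size Ls).-homog.
Proof.
elim: Ls => [|L Ls IH] h; first by rewrite big_nil dhomog1.
rewrite big_cons /= -add1n; apply: dhomogM; first by apply: h; exact: mem_head.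
by apply: IH => M MLs; apply: h; rewrite inE MLs orbT.
Qed.

Section SeparableChart.
Variables (F : numClosedFieldType) (a : 'I_3 -> F) (i j k : 'I_3).
Hypothesis ai0 : a i != 0.
Hypotheses (ji : j != i) (ki : k != i) (kj : k != j).
Local Notation S := {mpoly F[3]}.
Local Notation phi := (phi a j k).
Local Notation lf0 := (lf (c0 a i j)).
Local Notation lfz z := (lf (fun l => c2 a i k l - z * c0 a i j l)).

Lemma lf_prime_elt n (c : 'I_n -> F) l : c l != 0 -> prime_elt (lf c).
Proof.
by move=> cl; split; [exact: lf_neq0 cl | move=> p q u; exact: lf_prime cl].
Qed.

Lemma lf0_prime : prime_elt lf0.
Proof.
by apply: (@lf_prime_elt _ _ j); rewrite /c0 eqxx (negbTE ji) mulr0 subr0 oner_eq0.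
Qed.

Lemma lfz_prime z : prime_elt (lfz z).
Proof.
apply: (@lf_prime_elt _ _ k); rewrite /c0 /c2 eqxx (negbTE ki) (negbTE kj).
by rewrite !mulr0 subr0 sub0r oppr0 mulr0 subr0 oner_eq0.
Qed.

Lemma lfzE z : lfz z = lf (c2 a i k) - z%:MP * lf0.
Proof.
rewrite /lf mulr_sumr -sumrB; apply: eq_bigr => l _.
by rewrite rmorphB rmorphM /=; ring.
Qed.

Lemma phi_lfz z : phi (lfz z) = ('X - z%:P)%:P.
Proof.
have [_ e0 e2] := phi_lf ai0 ji ki kj.
by rewrite lfzE phiB phiM e0 e2 phiC mulr1 -polyCB.
Qed.

Definition reduced_poly (f : S) :=
  forall p u : S, f = p * p * u -> (msize p <= 1)%N.

(** Divisibility in [s] is up to a nonzero factor [c] in [y]. Homogenised, [c] becomes a product of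
    linear forms, which are prime and can be cancelled; reducedness of [f] then makes [u] constant
    in [s]. *)
Lemma phi_square_free d (f : S) : f \is d.-homog -> f != 0 -> reduced_poly f ->
  forall u : {poly {poly F}}, size u != 1 -> ~~ (u ^+ 2 %| phi f).
Proof.
move=> hf f0 fred u su; apply/negP => /Pdiv.Idomain.dvdpP [[c q] /= cn0 e].
have phif0 : phi f != 0.
  by apply: contraNneq f0 => /(phi_inj ai0 ji ki kj hf) ->.
have [rs ec] := closed_field_poly_normal (c : {poly F}).
have lc0 : lead_coef c != 0 by rewrite lead_coef_eq0.
have [_ e0 e2] := phi_lf ai0 ji ki kj.
have [N hN] := phi_surj ai0 ji ki kj u.
have [N' hN'] := phi_surj ai0 ji ki kj ((lead_coef c)^-1%:P *: q).
have [G hG eG] := hN N (leqnn _).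
have [U hU eU] := hN' (maxn N' (size rs + d)) (leq_maxl _ _).
set n' := maxn _ _ in hU.
(* The exponent of [lf0] that equalises the degrees of the two sides; [n'] is large enough for the
   subtraction to be exact. *)
pose t := (N + N + n' - (size rs + d))%N.
pose Ls := nseq t lf0 ++ [seq lfz z | z <- rs].
have LsP L : L \in Ls -> [/\ L \is 1.-homog, prime_elt L & exists w, phi L = w%:P].
  rewrite mem_cat mem_nseq => /orP [/andP [_ /eqP ->]|/mapP [z _ ->]].
    by split; [exact: lf_homog | exact: lf0_prime | exists 1; rewrite e0].
  split; [exact: lf_homog | exact: lfz_prime |].
  by exists ('X - z%:P); rewrite phi_lfz.
have phi_prod (Ms : seq S) : {subset Ms <= Ls} ->
    exists w, phi (\prod_(L <- Ms) L) = w%:P.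
  elim: Ms => [|M Ms IH] sM; first by exists 1; rewrite big_nil -[1 : S]mpolyC1 phiC.
  have [w ew] := IH (fun L hL => sM L (mem_behead (s := M :: Ms) hL)).
  have [_ _ [w' ew']] := LsP M (sM M (mem_head _ _)).
  by exists (w' * w); rewrite big_cons phiM ew ew' -polyCM.
have key : (\prod_(L <- Ls) L) * f = G * G * U.
  apply/eqP; rewrite -subr_eq0; apply/eqP.
  apply: (phi_inj ai0 ji ki kj (n := (N + N + n')%N)).
    apply: rpredB; last by do 2?[apply: dhomogM => //].
    have -> : (N + N + n' = size Ls + d)%N.
      rewrite /Ls size_cat size_nseq size_map /t -[RHS]addnA subnK //.
      by rewrite (leq_trans (leq_maxr N' _)) // leq_addl.
    by apply: dhomogM => //; apply: prod_homog1 => L /LsP [].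
  rewrite phiB !phiM eG eU; apply/eqP; rewrite subr_eq0; apply/eqP.
  have -> : phi (\prod_(L <- Ls) L) = ((lead_coef c)^-1 *: c)%:P.
    rewrite {2}ec scalerA mulVf // scale1r big_cat /= phiM.
    have -> : phi (\prod_(L <- nseq t lf0) L) = 1.
      rewrite big_nseq; elim: (t) => [|s IHs] /=; first by rewrite -[1 : S]mpolyC1 phiC.
      by rewrite phiM IHs e0 mulr1.
    rewrite mul1r big_map rmorph_prod; elim: (rs) => [|z zs IHz].
      by rewrite !big_nil -[1 : S]mpolyC1 phiC.
    by rewrite !big_cons phiM IHz phi_lfz.
  have -> : ((lead_coef c)^-1 *: c)%:P * phi f = (lead_coef c)^-1%:P%:P * (c *: phi f).
    by rewrite -!mul_polyC polyCM mulrA.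
  by rewrite e -mul_polyC; ring.
have [p' [u' [Ms [ef sM eGM]]]] := prime_cancel_square (fun L hL => let: And3 _ h _ := LsP L hL in h) key.
have /msize1_polyC ep' := fred _ _ ef.
have [w ew] := phi_prod _ sM.
have u0 : u != 0.
  apply: contraNneq phif0 => u0; move/eqP: e; rewrite u0 expr0n /= mulr0 -mul_polyC.
  by rewrite mulf_eq0 polyC_eq0 (negbTE cn0).
have : size u == 1%N.
  move: eG u0; rewrite eGM phiM ew ep' phiC -polyCM => <- {u su e G eGM hG hN key}.
  by rewrite polyC_eq0 size_polyC => ->.
by rewrite (negbTE su).
Qed.

Lemma separable_phi d (f : S) : f \is d.-homog -> f != 0 -> reduced_poly f ->
  separable_poly (phi f).
Proof.
move=> hf f0 fred; apply/separable_polyP; split.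
  by apply/poly_square_freeP; exact: phi_square_free hf f0 fred.
(* In characteristic 0 a polynomial of positive degree has nonzero derivative, as its leading
   coefficient shows. *)
move=> u _ su; apply/eqP => /(congr1 (fun p : {poly {poly F}} => p`_(size u).-2)).
rewrite coef_deriv coef0; have -> : (size u).-2.+1 = (size u).-1 by case: (size u) su => [|[]].
move/eqP; rewrite -scaler_nat -/(lead_coef u) -mul_polyC mulf_eq0 polyC_eq0 pnatr_eq0.
by rewrite lead_coef_eq0 -size_poly_eq0; case: (size u) su => [|[]].
Qed.

(* By separability some [D(y) <> 0] lies in the ideal of [phi f] and its
   derivative; the line is chosen at a point where [D] does not vanish. *)
Lemma transversal_line d (f : S) :
  f \is d.-homog -> f != 0 -> reduced_poly f ->
  exists al (p q : {poly F}),
    let F_al := map_poly (horner_eval al) (phi f) in p * F_al + q * F_al^`() = 1.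
Proof.
move=> hf f0 fred; have := separable_phi hf f0 fred; rewrite unlock.
case/Bezout_coprimepP => -[u v] /=; rewrite -size_poly_eq1 => /size_poly1P [D D0 e].
have [al Dal] := closed_nonrootP _ D0; rewrite /root in Dal.
pose r := map_poly (horner_eval al).
exists al, (D.[al]^-1 *: r u), (D.[al]^-1 *: r v) => /=.
rewrite deriv_map -!scalerAl -scalerDr -!rmorphM -rmorphD e /= map_polyC /=.
by rewrite /horner_eval -mul_polyC -polyCM mulVf.
Qed.

End SeparableChart.

(** * Restriction to the transversal line *)

Lemma mderiv_homog n (R : idomainType) d i (p : {mpoly R[n]}) :
  p \is d.+1.-homog -> p^`M(i) \is d.-homog.
Proof.
move=> hp; apply/dhomogP => m; rewrite mcoeff_msupp mcoeff_mderiv => pm.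
have /(dhomog_mf hp) : (m + U_(i))%MM \in msupp p.
  by rewrite mcoeff_msupp; apply: contraNneq pm => ->; rewrite mul0rn.
by rewrite /= mdegD mdeg1 addn1 => -[].
Qed.

Lemma homog_sum_X n (R : comNzRingType) d (p : {mpoly R[n]}) : p \is d.+1.-homog ->
  exists2 q : 'I_n -> {mpoly R[n]}, forall l, q l \is d.-homog & p = \sum_l q l * 'X_l.
Proof.
move=> hp; have [q] := mmap_sub_ideal (@mpolyC n R) (fun l => 'X_l : {mpoly R[n]})
  (* The value 0 is written [0 * 0] so that [mmap_homogZ] applies with scalar 0 and gives
     [0 ^+ d.+1]. *)
  (fun=> 0 * 0) p.
rewrite (mmap_homogZ _ _ _ hp) expr0n mul0r subr0 mmap_mpolyC_id => e.
exists (fun l => pihomog mdeg d (q l)) => [l|]; first exact: pihomogP.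
rewrite -{1}(pihomog_dE hp) e raddf_sum; apply: eq_bigr => l _ /=.
rewrite mulr0 subr0 mulrC -[d.+1]addn1 pihomog_mulr; first by rewrite mulrC.
by rewrite dhomogX /= mdeg1.
Qed.

Section LineIdeal.
Variables (F : numClosedFieldType) (a : 'I_3 -> F) (i j k : 'I_3).
Hypothesis ai0 : a i != 0.
Hypotheses (ji : j != i) (ki : k != i) (kj : k != j).
Local Notation S := {mpoly F[3]}.
Variables (d : nat) (f : S).
Hypothesis f_homog : f \is d.+1.-homog.
Hypothesis fa : f.@[a] != 0.
Variables (al : F) (p0 q0 : {poly F}).
Local Notation phi := (phi a j k).
Hypothesis bezout : let F_al := map_poly (horner_eval al) (phi f) in
  p0 * F_al + q0 * F_al^`() = 1.

(** The line [L = 0] is spanned by [a] and [b]; on it [l1] and [l0] are the dual coordinates. *)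
Let l1 := lf (c1 a i).
Let l0 := lf (c0 a i j).
Let L := lf (fun l => c2 a i k l - al * c0 a i j l).
Let b l : F := (l == j)%:R + al * (l == k)%:R.

(** The ideal of [L] and the partial derivatives of [f]. Once it contains all forms of large degree,
    multiplication by [L] is onto there in M(f). *)
Definition lineI (p : S) := exists q (c : 'I_3 -> S), p = L * q + \sum_l c l * f^`M(l).

Lemma lineI_L q : lineI (L * q).
Proof. by exists q, (fun=> 0); rewrite big1 ?addr0 // => l _; rewrite mul0r. Qed.

Lemma lineI_deriv l : lineI f^`M(l).
Proof.
exists 0, (fun l' => (l' == l)%:R); rewrite mulr0 add0r (bigD1 l) //= eqxx mul1r.
by rewrite big1 ?addr0 // => l' /negbTE ->; rewrite mul0r.
Qed.

Lemma lineID p q : lineI p -> lineI q -> lineI (p + q).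
Proof.
move=> [u [c ->]] [v [c' ->]]; exists (u + v), (fun l => c l + c' l).
rewrite mulrDr addrACA -big_split; congr (_ + _); apply: eq_bigr => l _ /=.
by rewrite mulrDl.
Qed.

Lemma lineIM w p : lineI p -> lineI (w * p).
Proof.
move=> [u [c ->]]; exists (w * u), (fun l => w * c l).
rewrite mulrDr mulrCA mulr_sumr; congr (_ + _); apply: eq_bigr => l _ /=.
by rewrite mulrA.
Qed.

Lemma lineI_sum (c q : 'I_3 -> S) : (forall l, lineI (q l)) ->
  lineI (\sum_l c l * q l).
Proof.
move=> hq; elim/big_ind: _ => [||l _]; last exact: lineIM.
  by have := lineI_L 0; rewrite mulr0.
exact: lineID.
Qed.

(** Euler's relation, the degree [d.+1] being invertible in characteristic 0. *)
Lemma lineI_f : lineI f.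
Proof.
have := euler_homog f_homog => /(congr1 (fun p => d.+1%:R^-1 *: p)).
rewrite -[f *+ _]scaler_nat scalerA mulVf ?pnatr_eq0 // scale1r => <-.
rewrite -mul_mpolyC; apply/lineIM/lineI_sum => l; exact: lineI_deriv.
Qed.

Lemma LE : L = lf (c2 a i k) - al%:MP * l0.
Proof. exact: lfzE. Qed.

Lemma X_dual l : 'X_l = (a l)%:MP * l1 + (l == j)%:R * l0 + (l == k)%:R * lf (c2 a i k) :> S.
Proof.
by rewrite [LHS](dual_basis ai0 ji ki kj (@mpolyC 3 F) (fun l => 'X_l)) !mmap_mpolyC_id.
Qed.

Lemma X_mod_L l : 'X_l - ((a l)%:MP * l1 + (b l)%:MP * l0) = (l == k)%:R * L.
Proof.
rewrite {1}X_dual LE /b mpolyCD mpolyCM.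
by case: (l == j); case: (l == k) => /=; rewrite ?mpolyC0 ?mpolyC1; ring.
Qed.

(** Restriction to the affine line [s a + b]. *)
Definition psi : S -> {poly F} := mmap polyC (fun l => (a l)%:P * 'X + (b l)%:P).

Lemma psiE p : map_poly (horner_eval al) (phi p) = psi p.
Proof.
pose r : {rmorphism {poly {poly F}} -> {poly F}} := map_poly (horner_eval al).
rewrite -[LHS]/(r (phi p)) rmorph_mmap; apply: eq_bigr => m _; congr (_ * _).
  by rewrite /= map_polyC /= /horner_eval hornerC.
apply: mmap1_eq => l; rewrite /= -[map_poly _ _]/(r _) /chart /b.
have rC (u : {poly F}) : r u%:P = (u.[al])%:P by rewrite /= map_polyC.
have rX : r 'X = 'X by rewrite /= map_polyX.
case: (l == j); case: (l == k); rewrite /= !(rmorphD r) !(rmorphM r) ?(rmorph0 r) ?(rmorph1 r).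
all: by rewrite !rC rX ?hornerX hornerC ?mulr0 ?mulr1 ?polyCD ?polyC0 ?polyC1; ring.
Qed.

Lemma psi_deriv p : (psi p)^`() = psi (\sum_l (a l)%:MP * p^`M(l)).
Proof.
rewrite /psi deriv_mmap raddf_sum; apply: eq_bigr => l _ /=.
rewrite !derivE mul_mpolyC mmapZ /=; congr (_ * _).
by rewrite mul0r addr0.
Qed.

(** Modulo [L], [p] is congruent to [sp], its value at [l1 a + l0 b]. Where [l0] is nonzero, [sp] is
    a power of [l0] times a value of [psi p], so it vanishes. *)
Lemma lineI_psi0 n (p : S) : p \is n.-homog -> psi p = 0 -> lineI p.
Proof.
move=> hp p0'.
have [c] := mmap_sub_ideal (@mpolyC 3 F) (fun l => 'X_l : S)
  (fun l => (a l)%:MP * l1 + (b l)%:MP * l0) p.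
rewrite mmap_mpolyC_id; set sp := mmap _ _ p; suff -> : sp = 0.
  rewrite subr0 => ->; under eq_bigr do rewrite X_mod_L mulrCA mulrA mulrC.
  by rewrite -mulr_sumr; exact: lineI_L.
have l0n : l0 != 0 by case: (lf0_prime a ji).
apply/eqP; apply: contraNT (l0n) => spn; have /mpoly_nonroot [v] : l0 * sp != 0.
  by rewrite mulf_neq0.
rewrite mevalM mulf_eq0 => /norP [v0]; case/eqP.
pose s := l1.@[v] / l0.@[v].
transitivity (p.@[fun l => l0.@[v] * (a l * s + b l)]).
  rewrite /sp /meval (rmorph_mmap (meval v)); apply: eq_bigr => m _.
  congr (_ * _); first by rewrite /= mevalC.
  apply: mmap1_eq => l; rewrite /= mevalD !mevalM !mevalC mulrDr mulrCA.
  by rewrite [_ * s]mulrC divfK // [l0.@[v] * _]mulrC.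
rewrite /meval (mmap_homogZ _ _ _ hp).
suff -> : mmap idfun (fun l => a l * s + b l) p = horner_eval s (psi p).
  by rewrite p0' rmorph0 mulr0.
rewrite rmorph_mmap; apply: eq_bigr => m _; congr (_ * _).
  by rewrite /= /horner_eval hornerC.
by apply: mmap1_eq => l; rewrite /= /horner_eval !hornerE.
Qed.

Lemma psi_surj (u : {poly F}) : exists N, forall n, (N <= n)%N ->
  exists2 p : S, p \is n.-homog & psi p = u.
Proof.
have [N hN] := phi_surj ai0 ji ki kj (map_poly polyC u).
exists N => n /hN [p hp ep]; exists p => //; rewrite -psiE ep -map_poly_comp.
by apply/polyP => t; rewrite coef_map_id0 /= /horner_eval hornerC.
Qed.

(** The identity [bezout] is homogenised: [G] and [H] lift its coefficients, and [l0] is a form with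
    image 1. *)
Lemma lineI_l0 : exists N, lineI (l0 ^+ N).
Proof.
have [N hN] := psi_surj p0; have [N' hN'] := psi_surj q0.
have [G hG eG] := hN (maxn N N') (leq_maxl _ _).
(* [H] has degree one more than [G] because it multiplies a derivative of [f] rather than [f]. *)
have [H hH eH] := hN' (maxn N N').+1 (leqW (leq_maxr _ _)).
set n := maxn _ _ in hG hH; exists (n + d.+1)%N.
pose fa' := \sum_l (a l)%:MP * f^`M(l).
have -> : l0 ^+ (n + d.+1) = (l0 ^+ (n + d.+1) - G * f - H * fa') + (G * f + H * fa').
  by ring.
apply: lineID; last first.
  apply: lineID; first exact/lineIM/lineI_f.
  by apply/lineIM/lineI_sum => l; exact: lineI_deriv.
have hfa' : fa' \is d.-homog.
  by apply: rpred_sum => l _; rewrite mul_mpolyC; apply/dhomogZ/mderiv_homog.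
apply: (@lineI_psi0 (n + d.+1)).
  apply: rpredB; last by rewrite addnS -addSn; exact: dhomogM.
  apply: rpredB; last exact: dhomogM.
  by have := dhomogMn (n + d.+1) (lf_homog (c0 a i j)); rewrite mul1n.
have psiM : {morph psi : u v / u * v} by move=> u v; exact: rmorphM.
have psi_l0 : psi l0 = 1.
  by have [_ e _] := phi_lf ai0 ji ki kj; rewrite -psiE e rmorph1.
have -> : psi (l0 ^+ (n + d.+1) - G * f - H * fa') =
    psi l0 ^+ (n + d.+1) - psi G * psi f - psi H * psi fa'.
  by rewrite /psi !raddfB /= !rmorphM rmorphXn.
rewrite psi_l0 expr1n eG eH -psi_deriv -!psiE /= -bezout /=; ring.
Qed.

(** Modulo [L] and [l0], the form [f] is [f.@[a]] times [l1 ^+ d.+1], and [a] lies off the curve. *)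
Lemma lineI_l1 : exists w, lineI (l1 ^+ d.+1 - l0 * w).
Proof.
have [c] := mmap_sub_ideal (@mpolyC 3 F) (fun l => 'X_l : S) (fun l => l1 * (a l)%:MP) f.
rewrite mmap_mpolyC_id (mmap_homogZ _ _ _ f_homog).
have -> : mmap (@mpolyC 3 F) (fun l => (a l)%:MP) f = (f.@[a])%:MP.
  by rewrite /meval (rmorph_mmap (@mpolyC 3 F)).
move=> e; set u := f.@[a] in e; have u0 : u != 0 := fa.
exists ((- u^-1)%:MP * \sum_l c l * ((l == j)%:R + (l == k)%:R * al%:MP)).
have -> : l1 ^+ d.+1 = (u^-1)%:MP * (l1 ^+ d.+1 * u%:MP).
  by rewrite mulrCA -mpolyCM mulVf // mulr1.
have -> : l1 ^+ d.+1 * u%:MP = f - \sum_l c l * ('X_l - l1 * (a l)%:MP).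
  by rewrite -e; ring.
have -> : \sum_l c l * ('X_l - l1 * (a l)%:MP) =
    l0 * (\sum_l c l * ((l == j)%:R + (l == k)%:R * al%:MP)) +
    L * (\sum_l c l * (l == k)%:R).
  rewrite !mulr_sumr -big_split; apply: eq_bigr => l _ /=.
  by rewrite {1}X_dual LE; ring.
set w := \sum_l _; set w' := \sum_l _.
have -> : (u^-1)%:MP * (f - (l0 * w + L * w')) - l0 * ((- u^-1)%:MP * w) =
    (u^-1)%:MP * f + L * (- ((u^-1)%:MP * w')).
  by rewrite mpolyCN; ring.
by apply: lineID; [exact/lineIM/lineI_f | exact: lineI_L].
Qed.

(** By [lineI_l1] a power of [l1] is congruent to a multiple of [l0], which is nilpotent modulo the
    ideal. *)
Lemma lineI_l1_pow : exists N, lineI (l1 ^+ N).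
Proof.
have [N hN] := lineI_l0; have [w hw] := lineI_l1.
exists (d.+1 * N)%N; rewrite exprM -[_ ^+ N](subrK ((l0 * w) ^+ N)).
apply: lineID; first by rewrite subrXX mulrC; exact: lineIM.
by rewrite exprMn mulrC; exact: lineIM.
Qed.

(** Modulo [L] a form of degree [n] is a form in [l1] and [l0], and each of its monomials is
    divisible by [l1 ^+ s] or [l0 ^+ t]. Induction on [s + t] splits off one factor [l1] or [l0]. *)
Lemma lineI_powers s t n (p : S) : p \is n.-homog -> (s + t <= n.+1)%N ->
  exists u v, lineI (p - u * l1 ^+ s - v * l0 ^+ t).
Proof.
have I0 : lineI 0 by have := lineI_L 0; rewrite mulr0.
move: {2}(s + t)%N (leqnn (s + t)) => w.
elim: w s t n p => [|w IH] [|s] [|t] n p //.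
all: rewrite ?addn0 ?add0n => le_w hp le_n.
1,2,3: by exists p, 0; rewrite expr0 mulr1 mul0r subrr subr0.
  by exists 0, p; rewrite expr0 mulr1 mul0r subr0 subrr.
case: n hp le_n => [|n] hp le_n; first by move: le_n; rewrite addSn addnS.
have [q hq e] := homog_sum_X hp.
have hc (c : 'I_3 -> F) : \sum_l (c l)%:MP * q l \is n.-homog.
  by apply: rpred_sum => l _; rewrite mul_mpolyC; exact: dhomogZ.
have [|| u1 [v1 h1]] := IH s t.+1 n _ _ (hc a) _.
- by rewrite -ltnS -addSn.
- by rewrite -ltnS -addSn.
have [|| u2 [v2 h2]] := IH s.+1 t n _ _ (hc b) _.
- by rewrite -ltnS -addnS.
- by rewrite -ltnS -addnS.
exists (u1 + l0 * u2), (l1 * v1 + v2).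
have -> : p - (u1 + l0 * u2) * l1 ^+ s.+1 - (l1 * v1 + v2) * l0 ^+ t.+1 =
  L * (\sum_l (l == k)%:R * q l) +
  l1 * (\sum_l (a l)%:MP * q l - u1 * l1 ^+ s - v1 * l0 ^+ t.+1) +
  l0 * (\sum_l (b l)%:MP * q l - u2 * l1 ^+ s.+1 - v2 * l0 ^+ t).
  suff -> : p = L * (\sum_l (l == k)%:R * q l) + l1 * (\sum_l (a l)%:MP * q l) +
      l0 * (\sum_l (b l)%:MP * q l) by rewrite !exprS; ring.
  rewrite e !mulr_sumr -!big_split; apply: eq_bigr => l _ /=.
  rewrite -[in LHS](subrK ((a l)%:MP * l1 + (b l)%:MP * l0) 'X_l) X_mod_L.
  by ring.
by apply: lineID; [apply: lineID; [exact: lineI_L | exact: lineIM] | exact: lineIM].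
Qed.

Lemma lineI_large : exists N, forall n (p : S), (N <= n)%N -> p \is n.-homog -> lineI p.
Proof.
have [N0 h0] := lineI_l0; have [N1 h1] := lineI_l1_pow.
exists (N1 + N0)%N => n p le_n hp.
have [u [v h]] := lineI_powers hp (leqW le_n).
have -> : p = (p - u * l1 ^+ N1 - v * l0 ^+ N0) + u * l1 ^+ N1 + v * l0 ^+ N0 by ring.
by apply: lineID; [apply: lineID => //; exact: lineIM | exact: lineIM].
Qed.

End LineIdeal.

Lemma transversal_line_ideal (F : numClosedFieldType) d (f : {mpoly F[3]}) :
  f \is d.+1.-homog -> f != 0 -> reduced_poly f ->
  exists2 L : {mpoly F[3]}, L \is 1.-homog & exists N, forall n (p : {mpoly F[3]}),
    (N <= n)%N -> p \is n.-homog ->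
    exists q (c : 'I_3 -> {mpoly F[3]}), p = L * q + \sum_l c l * f^`M(l).
Proof.
move=> hf f0 fred; have [a fa] := mpoly_nonroot f0.
have [i ai] : exists i, a i != 0.
  apply/existsP; apply: contraNT fa => /existsPn /= a0; apply/eqP.
  have -> : f.@[a] = mmap idfun (fun l => 0 * a l) f.
    by apply: eq_mmap => l; rewrite mul0r; apply/eqP; rewrite -[_ == _]negbK a0.
  by rewrite (mmap_homogZ _ _ _ hf) expr0n mul0r.
have [j [k [ji ki kj]]] : exists j k : 'I_3, [/\ j != i, k != i & k != j].
  have h10 : inord 1 != ord0 :> 'I_3 by rewrite -val_eqE /= inordK.
  have h21 : ord_max != inord 1 :> 'I_3 by rewrite -val_eqE /= inordK.
  have h01 : ord0 != inord 1 :> 'I_3 by rewrite eq_sym.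
  have h12 : inord 1 != ord_max :> 'I_3 by rewrite eq_sym.
  have h20 : ord_max != ord0 :> 'I_3 by rewrite -val_eqE.
  have h02 : ord0 != ord_max :> 'I_3 by rewrite eq_sym.
  by elim/ord3P: i {ai};
    [exists (inord 1), ord_max | exists ord0, ord_max | exists ord0, (inord 1)].
have [al [p0 [q0 bez]]] := transversal_line ai ji ki kj hf f0 fred.
exists (lf (fun l => c2 a i k l - al * c0 a i j l)); first exact: lf_homog.
have [N hN] := lineI_large ai ji ki kj hf fa bez.
by exists N => n p leN hp; exact: hN leN hp.
Qed.

(** * The Milnor algebra *)

(** The hypotheses say that [h] induces a surjection from [V / J] onto [V' / J']; the dimensions are
    compared without forming quotients. *)
Lemma dim_quotient_le (F : fieldType) (V V' : vectType F) (h : 'Hom(V, V'))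
    (J : {vspace V}) (J' : {vspace V'}) :
  (h @: J <= J')%VS -> (fullv <= limg h + J')%VS ->
  (\dim {:V'} + \dim J <= \dim {:V} + \dim J')%N.
Proof.
move=> sJ sfull; have := dimvS sfull.
have := dimv_sum_cap (limg h) J'.
have := limg_ker_dim h fullv; rewrite capfv.
have := limg_ker_dim h J.
have : (\dim (J :&: lker h) <= \dim (lker h))%N by rewrite dimvS ?capvSr.
have : (\dim (h @: J) <= \dim (limg h :&: J'))%N.
  by rewrite dimvS // subv_cap sJ limgS ?subvf.
move: (\dim (J :&: _)) (\dim (lker h)) (\dim (h @: J)) (\dim (_ :&: J')) (\dim (limg h)).
move: (\dim J) (\dim J') (\dim (_ + _)) (\dim {:V}) (\dim {:V'}) => *; lia.
Qed.

Lemma homog0_const n (R : comNzRingType) (p : {mpoly R[n]}) : p \is 0.-homog ->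
  exists c, p = c%:MP.
Proof.
move=> hp; exists (p.@[fun=> 0]).
rewrite -{1}[p]mmap_mpolyC_id -[LHS]mul1r -(expr0 0) -(mmap_homogZ _ _ _ hp).
rewrite /meval (rmorph_mmap (@mpolyC n R)); apply: eq_mmap => i /=.
by rewrite mul0r mpolyC0.
Qed.

(** A nonzero entry of a relation of degree 0 is an invertible constant, so the corresponding
    generator could be eliminated. *)
Lemma minimal_relK0 (F : fieldType) m r (rho : 'M[{mpoly F[3]}]_(m, 3))
    (g : 'cV[{mpoly F[3]}]_3) :
  homog_mx r rho -> rho *m g = 0 ->
  (forall w : 'rV_3, w *m g = 0 -> exists u, w = u *m rho) ->
  (forall t (h : 'M_(t, 3)), homog_mx r h -> h *m g = 0 ->
     (forall w : 'rV_3, w *m g = 0 -> exists u, w = u *m h) -> (m <= t)%N) ->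
  relK r rho 0 = 0%VS.
Proof.
move=> hrho rhog gen minim; apply/eqP; rewrite -subv0; apply/subvP => u.
rewrite (mem_relK hrho) memv0 => /eqP ur.
apply/eqP/ffunP => i; rewrite ffunE; apply/eqP; apply/negPn/negP => ui.
case: m => [|m] in rho hrho rhog gen minim u ur i ui *; first by case: i ui.
have [c ec] : exists c, (u i : {mpoly F[3]}) = c%:MP.
  by apply: homog0_const; exact: dhomog_is_dhomog.
have c0 : c != 0.
  by apply: contraNneq ui => c0; apply/eqP/val_inj; rewrite /= ec c0 mpolyC0.
suff : (m.+1 <= m)%N by rewrite ltnn.
apply: (minim m (row' i rho)).
- by move=> j l; rewrite mxE.
- by rewrite -[RHS](raddf0 (row' i)) -rhog; apply/matrixP => j l; rewrite !mxE;
    apply: eq_bigr => s _; rewrite mxE.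
move=> w /gen [v ->].
(* Subtracting a multiple of the relation clears the coefficient of the generator to be dropped. *)
pose v' : 'rV_m.+1 := v - (v 0 i * c^-1%:MP) *: row_of u.
have v'i : v' 0 i = 0.
  by rewrite !mxE ec -mulrA -mpolyCM mulVf // mulr1 subrr.
exists (col' i v').
have -> : v *m rho = v' *m rho by rewrite mulmxBl -scalemxAl ur scaler0 subr0.
apply/rowP => l; rewrite !mxE (bigD1_ord i) //= v'i mul0r add0r.
by apply: eq_bigr => j _; rewrite !mxE.
Qed.

(** * The Jacobian ideal and its codimension, degree by degree *)

Section Jacobian.
Variables (F : numClosedFieldType) (D : nat) (f : {mpoly F[3]}).
Hypothesis f_homog : f \is D.+1.-homog.
Local Notation S := {mpoly F[3]}.

Definition gradc : 'cV[S]_3 := \col_l f^`M(l).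

Lemma gradc_homog : homog_mx D gradc.
Proof. by move=> i j; rewrite mxE; exact: mderiv_homog. Qed.

Lemma mul_gradc (v : 'rV[S]_3) : (v *m gradc) 0 0 = \sum_l v 0 l * f^`M(l).
Proof. by rewrite mxE; apply: eq_bigr => l _; rewrite mxE. Qed.

Definition jacobian_mem (p : S) := exists c : 'I_3 -> S, p = \sum_l c l * f^`M(l).

Lemma mem_Jgr p (v : gr F 1 (p + D)) :
  v \in Jgr D gradc p <-> jacobian_mem (row_of v 0 0).
Proof.
split=> [/memv_imgP [u _ ->]|[c ec]].
  exists (fun l => row_of u 0 l); rewrite (row_of_mxgr _ gradc_homog) //.
  exact: mul_gradc.
have -> : v = mxgr gradc p (p + D) (gr_of p (\row_l c l)); last by rewrite memv_img ?memvf.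
apply: row_of_inj; rewrite (row_of_mxgr _ gradc_homog) // row_of_gr_of.
rewrite -(hcomp_mulmx _ _ gradc_homog).
have -> : (\row_l c l) *m gradc = row_of v.
  apply/rowP => i; rewrite ord1 mul_gradc ec; apply: eq_bigr => l _.
  by rewrite mxE.
by rewrite hcomp_id //; exact: homog_row_of.
Qed.

(* The dimension of M(f) in degree p + D; degrees below D are never needed. *)
Definition hM p := (\dim {:gr F 1 (p + D)} - \dim (Jgr D gradc p))%N.

Lemma dim_Jgr_le p : (\dim (Jgr D gradc p) <= \dim {:gr F 1 (p + D)})%N.
Proof. by rewrite dimvS ?subvf. Qed.

Lemma hM_nonincr : f != 0 -> reduced_poly f ->
  exists N, forall p, (N <= p)%N -> (hM p.+1 <= hM p)%N.
Proof.
move=> f0 fred; have [L hL [N hN]] := transversal_line_ideal f_homog f0 fred.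
exists N => p leN; have hLM : homog_mx 1 (L%:M : 'M_1).
  by move=> i j; rewrite mxE !ord1 eqxx mulr1n.
pose h := mxgr (L%:M : 'M_1) (p + D) (p.+1 + D).
have hE u : row_of (h u) = L *: row_of u.
  by rewrite (row_of_mxgr _ hLM) ?mul_mx_scalar // addSn addn1.
suff : (\dim {:gr F 1 (p.+1 + D)} + \dim (Jgr D gradc p) <=
        \dim {:gr F 1 (p + D)} + \dim (Jgr D gradc p.+1))%N.
  move: (dim_Jgr_le p) (dim_Jgr_le p.+1); rewrite /hM.
  move: (\dim _) (\dim _) (\dim _) (\dim _) => *; lia.
apply: (dim_quotient_le (h := h)).
  apply/subvP => _ /memv_imgP [u /mem_Jgr [c ec] ->]; apply/mem_Jgr.
  exists (fun l => L * c l); rewrite hE mxE ec mulr_sumr.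
  by apply: eq_bigr => l _; rewrite mulrA.
apply/subvP => v _.
have [|q [c ec]] := hN (p.+1 + D)%N (row_of v 0 0) _ (homog_row_of v 0 0).
  by rewrite addSn (leq_trans leN) // leqW // leq_addr.
pose u := gr_of (p + D) (\row_(_ < 1) q).
have ev : row_of v - row_of (h u) = hcomp (p.+1 + D) ((\row_l c l) *m gradc).
  rewrite hE row_of_gr_of; apply/rowP => i; rewrite !ord1 !mxE.
  have -> : \sum_l (\row_l0 c l0) 0 l * gradc l 0 = \sum_l c l * f^`M(l).
    by apply: eq_bigr => l _; rewrite !mxE.
  have -> : \sum_l c l * f^`M(l) = row_of v 0 0 - L * q by rewrite ec addrC addKr.
  have e1 : (p.+1 + D = p + D + 1)%N by rewrite addn1.
  have eL : pihomog mdeg (p.+1 + D) (L * q) = L * pihomog mdeg (p + D) q.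
    by rewrite e1 pihomog_mulr.
  by rewrite raddfB /= eL mxE [in RHS]pihomog_dE //; exact: dhomog_is_dhomog.
rewrite -(subrK (h u) v) addrC; apply: memv_add; first by rewrite memv_img ?memvf.
apply/mem_Jgr; exists (fun l => hcomp p.+1 (\row_l c l) 0 l).
rewrite -mul_gradc -(hcomp_mulmx _ _ gradc_homog) -ev.
by rewrite !mxE !ffunE.
Qed.

(** One way, take [t] vectors of a basis of a complement of [J]. The other way, [t] forms
    independent modulo [J] span a space of dimension [t] meeting [J] trivially. *)
Lemma indep_mod_JP p t : (t <= hM p)%N <->
  exists P : 'I_t -> S, (forall s, P s \is (p + D).-homog) /\
    forall c : 'I_t -> F, (exists s, c s != 0) ->
      ~ jacobian_mem (\sum_(s < t) c s *: P s).
Proof.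
pose J := Jgr D gradc p.
have rowE n (v : 'I_t -> gr F 1 n) c :
    row_of (\sum_s c s *: v s) 0 0 = \sum_s c s *: (row_of (v s) 0 0).
  elim/big_rec2: _ => [|s y1 y2 _ IH]; first by rewrite row_of0 mxE.
  by rewrite row_ofD row_ofZ mxE IH mxE mul_mpolyC.
split=> [le_t|[P [hP indep]]].
  pose B := vbasis (J^C)%VS.
  have szX : size (take t B) == t by rewrite size_takel // size_tuple dimv_compl.
  pose X := Tuple szX.
  have /freeP frX : free X.
    by apply: (@catl_free _ _ (drop t B)); rewrite cat_take_drop (basis_free (vbasisP _)).
  exists (fun s => row_of X`_s 0 0); split=> [s|c [s0 cs0]]; first exact: homog_row_of.
  rewrite -(rowE _ (fun s : 'I_t => X`_s)) => /mem_Jgr Jv; case/eqP: cs0.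
  apply: frX; apply/eqP; rewrite -memv0 -(capv_compl J) memv_cap Jv.
  apply: memv_suml => s _; apply/memvZ/vbasis_mem/(mem_take (n0 := t))/mem_nth.
  by rewrite (eqP szX).
pose v s := gr_of (p + D) (\row_(_ < 1) P s).
have vE s : row_of (v s) 0 0 = P s by rewrite row_of_gr_of !mxE pihomog_dE.
have vJ c : (exists s, c s != 0) -> \sum_s c s *: v s \notin J.
  move=> /indep h; apply/negP => /mem_Jgr; rewrite rowE.
  by under eq_bigr do rewrite vE.
have /freeP frv : free [tuple v s | s < t].
  apply/freeP => c e0 s; apply: contraTeq isT => cs.
  have := vJ c (ex_intro _ s cs); suff -> : \sum_s c s *: v s = 0 by rewrite mem0v.
  by rewrite -[RHS]e0; apply: eq_bigr => s' _; rewrite nth_mktuple.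
have cap0 : (<<[tuple v s | s < t]>> :&: J = 0)%VS.
  apply/eqP; rewrite -subv0; apply/subvP => u; rewrite memv_cap => /andP [uX uJ].
  rewrite memv0; apply: contraLR uJ => u0.
  have eu := coord_span uX; pose c s := coord [tuple v s | s < t] s u.
  have {}eu : u = \sum_s c s *: v s.
    by rewrite [LHS]eu; apply: eq_bigr => s _; rewrite nth_mktuple.
  rewrite eu; apply: vJ; apply/existsP; apply: contraNT u0 => /existsPn /= c0.
  by rewrite eu big1 // => s _; have := c0 s; rewrite negbK => /eqP ->; rewrite scale0r.
have le : (\dim (<<[tuple v s | s < t]>> + J)%VS <= \dim {:gr F 1 (p + D)})%N.
  by rewrite dimvS ?subvf.
rewrite dimv_disjoint_sum // in le.
have := le; have -> : \dim <<[tuple v s | s < t]>> = t.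
  by apply/eqP; have := erefl (free [tuple v s | s < t]);
   rewrite {1}/free size_tuple => ->; apply/freeP.
by rewrite /hM => h; rewrite leq_subRL ?dim_Jgr_le // addnC.
Qed.

End Jacobian.

(** * The value of the Tjurina number *)

Lemma mul2_bin_addn2 n : (2 * 'C(n + 2, n) = (n + 1) * (n + 2))%N.
Proof.
elim: n => [|n IHn]; first by rewrite bin0.
by rewrite bin_addn2S mulnDr IHn; lia.
Qed.

(** The third hypothesis is the closed form [(m - 3) n + (m - 2) n (n - 1) / 2] of [kn], doubled.
    All terms in [n] cancel; the result is over the integers since [r] may be large. *)
Lemma tau_arithmetic (m r D n tau kn : nat) :
  (3 < m)%N -> (2 * r + 1 = D + m)%N ->
  (2 * kn + (m - 2) * n + 2 * n = (m - 2) * n * n + 2 * (m - 2) * n)%N ->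
  (tau + 3 * 'C(n + r + 2, n + r) + kn =
     'C(n + r + D + 2, n + r + D) + m * 'C(n + 2, n))%N ->
  (2 * tau%:Z = D.+1%:Z * D%:Z - 2 + 2 * r%:Z * (D.+1%:Z - r%:Z - 2))%R.
Proof.
move=> m3 rDm; have [M em] : exists M, m = (M + 2)%N by exists (m - 2)%N; lia.
have -> : (m - 2 = M)%N by lia.
have eM : M%:Z = 2 * r%:Z - 1 - D%:Z by lia.
move=> e1 e2.
have b1 := mul2_bin_addn2 (n + r); have b2 := mul2_bin_addn2 (n + r + D).
have b3 := mul2_bin_addn2 n.
have {}e1 : 2 * kn%:Z + M%:Z * n%:Z + 2 * n%:Z = M%:Z * n%:Z * n%:Z + 2 * M%:Z * n%:Z by lia.
have {b3}e3 : m%:Z * ((n%:Z + 1) * (n%:Z + 2)) = m%:Z * (2 * 'C(n + 2, n)%:Z).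
  by congr (_ * _); lia.
have {b1}e4 : 2 * 'C(n + r + 2, n + r)%:Z = (n%:Z + r%:Z + 1) * (n%:Z + r%:Z + 2) by lia.
have {b2}e5 : 2 * 'C(n + r + D + 2, n + r + D)%:Z =
  (n%:Z + r%:Z + D%:Z + 1) * (n%:Z + r%:Z + D%:Z + 2) by lia.
have {}e2 : tau%:Z + 3 * 'C(n + r + 2, n + r)%:Z + kn%:Z =
   'C(n + r + D + 2, n + r + D)%:Z + m%:Z * 'C(n + 2, n)%:Z by lia.
have emZ : m%:Z = M%:Z + 2 by lia.
rewrite emZ eM in e1 e2 e3 *.
move: ('C(_, _)%:Z) ('C(_, _)%:Z) ('C(_, _)%:Z) e1 e2 e3 e4 e5 => x1 x2 x3.
move: (tau%:Z) (kn%:Z) (r%:Z) (n%:Z) => t k R N.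
have -> : D.+1%:Z = D%:Z + 1 by lia.
move: (D%:Z) => d *; lia.
Qed.

Lemma hilbert_structure (F : numClosedFieldType) (D r m : nat)
    (f : {mpoly F[3]}) (rho : 'M[{mpoly F[3]}]_(m, 3)) :
  f \is D.+1.-homog -> f != 0 -> reduced_poly f ->
  (3 < m)%N -> (2 * r + 1 = D + m)%N ->
  homog_mx r rho -> rho *m gradc f = 0 ->
  (forall w : 'rV_3, w *m gradc f = 0 -> exists u, w = u *m rho) ->
  relK r rho 0 = 0%VS ->
  [/\ \dim (relW r rho 1) = (m - 3)%N, forall n, \dim (relW r rho n.+2) = (m - 2)%N &
   exists tau N, (forall p, (N <= p)%N -> hM D f p = tau) /\
   (2 * tau%:Z = D.+1%:Z * D%:Z - 2 + 2 * r%:Z * (D.+1%:Z - r%:Z - 2))%R].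
Proof.
move=> hf f0 fred m3 rDm hrho rhog gen K0.
pose w n := \dim (relW r rho n); pose k n := \dim (relK r rho n).
(* The shift by [r] matches relations with coefficients of degree [n] to syzygies of degree
   [n + r]. *)
pose h n := hM D f (n + r).
have k0 : k 0%N = 0%N by rewrite /k K0 dimv0.
have k1 : k 1%N = w 1%N by exact: dim_relK1 hrho rhog gen K0.
have kS n : (k n.+2 + k n = 2 * k n.+1 + w n.+2)%N by exact: dim_relK_rec hrho rhog gen n.
have w_mono n : (w n <= w n.+1)%N by rewrite dimvS // relW_mono.
have hE n : (h n + 3 * 'C(n + r + 2, n + r) + k n =
   'C(n + r + D + 2, n + r + D) + m * 'C(n + 2, n))%N.
  have := dim_Jgr hrho (gradc_homog hf) rhog gen n.
  have := dim_Jgr_le D f (n + r).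
  rewrite /h /hM dim_gr mul1n -/(k n).
  move: (\dim _) (k n) 'C(_, _) 'C(_, _) 'C(_, _) => j kn x y z; nia.
have [N hN] := hM_nonincr hf f0 fred.
have h_mono n : (N <= n)%N -> (h n.+1 <= h n)%N.
  by move=> le_n; apply: hN; rewrite (leq_trans le_n) // leq_addr.
have [w1 w2 kd] := hilbert_arithmetic m3 rDm k0 k1 kS w_mono hE h_mono.
split=> //.
have [N' hN'] := nonincr_eventually_const h_mono.
exists (h N'), (N' + r)%N; split.
  move=> p lep; rewrite -(hN' (p - r)%N); last by rewrite leq_subRL ?(leq_trans _ lep) ?leq_addl // addnC.
  by rewrite /h subnK // (leq_trans _ lep) // leq_addl.
apply: (tau_arithmetic m3 rDm _ (hE N')).
(* Summing the increments [kd] of [k] gives its closed form. *)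
elim: (N') => [|n IHn]; first by rewrite k0; lia.
by rewrite kd; nia.
Qed.

(** * From the formal statement to matrices and graded pieces *)

Section Translation.
Variables (f : {mpoly CC[3]}).

Lemma D0_mulmx (w : 'rV[{mpoly CC[3]}]_3) : D0 f w <-> w *m gradc f = 0.
Proof.
rewrite /D0 -(mul_gradc f w); split=> [e|->]; last by rewrite mxE.
by apply/matrixP => i j; rewrite !ord1 e mxE.
Qed.

Lemma mul_row_matrix (m : nat) (rho : 'I_m -> 'rV[{mpoly CC[3]}]_3) (a : 'rV_m) :
  a *m \matrix_j rho j = \sum_(j < m) a 0 j *: rho j.
Proof. by rewrite mulmx_sum_row; apply: eq_bigr => j _; rewrite rowK. Qed.

Lemma min_gens_matrix r m (rho : 'I_m -> 'rV[{mpoly CC[3]}]_3) :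
  min_gens_D0 f r rho -> let R := \matrix_j rho j in
  [/\ homog_mx r R, R *m gradc f = 0,
      forall w : 'rV_3, w *m gradc f = 0 -> exists u, w = u *m R
    & relK r R 0 = 0%VS].
Proof.
move=> [hrho [[rhoD gen] minim]] R.
have hR : homog_mx r R by move=> i j; rewrite mxE; exact: hrho.
have Rg : R *m gradc f = 0.
  by apply/row_matrixP => j; rewrite row_mul rowK row0; apply/D0_mulmx.
have genR (w : 'rV_3) : w *m gradc f = 0 -> exists u, w = u *m R.
  move=> hw; have [a ->] := gen _ ((D0_mulmx w).2 hw); exists (\row_j a j).
  by rewrite mul_row_matrix; apply: eq_bigr => j _; rewrite mxE.
split=> //; apply: minimal_relK0 hR Rg genR _ => t h hh hg genh.
apply: (minim t (fun j => row j h)).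
  by move=> j; exists r => i; rewrite mxE.
split=> [j|w hw]; last have [u ->] := genh _ ((D0_mulmx w).1 hw).
  by apply/D0_mulmx; rewrite -row_mul hg row0.
by exists (fun j => u 0 j); rewrite mulmx_sum_row.
Qed.

Lemma hilb_MJ_hM D p : f \is D.+1.-homog -> hilb_MJ f (p + D) (hM D f p).
Proof.
move=> hf; split; first exact/(indep_mod_JP hf).
by move=> /(indep_mod_JP hf); rewrite ltnn.
Qed.

End Translation.

Unset Implicit Arguments.

Theorem theorem3p2 (f : {mpoly CC[3]}) (d r m : nat) :
  (3 <= d)%N ->
  reduced f ->
  ~ lines_through_point d f ->
  curve_type f d r m ->
  (3 < m)%N ->
  ((2 * r%:Z - d%:Z + 3) - m%:Z = 1)%R ->
  (forall rho : 'I_m -> 'rV[{mpoly CC[3]}]_3, @min_gens_D0 f r m rho ->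
     exists b : 'I_(m - 2) -> 'rV[{mpoly CC[3]}]_m,
       generates (@relations m rho) b /\
       @needs_at_least m (m - 2) (@relations m rho) /\
       (forall j : 'I_(m - 2), (j < m - 3)%N -> homog_row 1 (b j)) /\
       (forall j : 'I_(m - 2), j = (m - 3)%N :> nat -> homog_row 2 (b j))) /\
  exists tau : nat, total_tjurina f tau /\
    (tau%:Z = ((d * (d - 1)) %/ 2)%N%:Z - 1 + r%:Z * (d%:Z - r%:Z - 2))%R.
Proof.
case: d => [//|D] _ [f0 fred] _ [hf [rho0 hrho0]] m3 dm.
have rDm : (2 * r + 1 = D + m)%N by lia.
split=> [rho hrho|].
  have [hR Rg gen K0] := min_gens_matrix hrho.
  have [W1 W2 _] := hilbert_structure hf f0 fred m3 rDm hR Rg gen K0.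
  have [b [b0 bgen b1 b2]] := relations_basis hR Rg gen K0 m3 W1 W2.
  exists b; split.
    split=> [j|v vr]; first by rewrite /relations -mul_row_matrix.
    by apply: bgen; rewrite mul_row_matrix.
  split.
    (* The lower bound [m - 2] is the dimension of [W 2]. *)
    move=> t h _ [_ hgen]; rewrite -(W2 0%N); apply: (relations_rank hR (h := h)).
    by move=> v vr; apply: hgen; rewrite /relations -mul_row_matrix.
  by split=> j hj i; [exact: b1 | exact: b2].
have [hR Rg gen K0] := min_gens_matrix hrho0.
have [_ _ [tau [N [htau etau]]]] := hilbert_structure hf f0 fred m3 rDm hR Rg gen K0.
(* The doubled equation itself shows that [d * (d - 1)] is even, so the division by 2 is exact. *)
exists tau; split; last by move: etau; rewrite subn1 /=; lia.
(* [hM] is indexed from degree [D] on, hence the shift of the bound. *)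
exists (N + D)%N => k lek; have leD : (D <= k)%N := leq_trans (leq_addl _ _) lek.
rewrite -(subnK leD) -(htau (k - D)%N); first exact: hilb_MJ_hM.
by rewrite leq_subRL // addnC.
Qed.
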